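(* For each $n\ge2$ let $W_n$ be one of the groups $S_n,B_n,D_n$, and let $d=d(n)\in\{1,\dots,d_{\max}-1\}$ satisfy $d=o(n^{1/3})$. Let $k_n\to\infty$ be positive integers, let $(X_{nj})_{j=1,\dots,k_n}$ be a row-wise i.i.d. triangular array with $X_{n1}$ distributed as $X_{\mathrm{inv}}^{(d)}$ on $W_n$, and let $M_n=\max\{X_{n1},\dots,X_{nk_n}\}$. Let $\sigma_n=\sqrt{\mathrm{Var}(X_{\mathrm{inv}}^{(d)})}$, $a_n=\sigma_n\alpha_{k_n}$ and $b_n=\sigma_n\beta_{k_n}+\mathbb E\bigl(X_{\mathrm{inv}}^{(d)}\bigr)$. If $k_n=\exp\bigl(o(n^{1/7}d^{-3/7})\bigr)$, then for all $x\in\mathbb R$, $$\mathbb P(M_n\le a_nx+b_n)\longrightarrow\exp(-\exp(-x))\qquad(n\to\infty).$$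
   Context: For an integer $k\ge2$, $\alpha_k=\frac1{\sqrt{2\log k}}$ and $\beta_k=\frac1{\alpha_k}-\frac12\alpha_k\bigl(\log\log k+\log(4\pi)\bigr)$. Set $d_{\max}=n$ for $S_n$, $d_{\max}=2n$ for $B_n$, $d_{\max}=2n-2$ for $D_n$. Let $Z_1,\dots,Z_n$ be i.i.d., uniform on $(0,1)$ for $S_n$ and uniform on $(-1,1)$ for $B_n$, $D_n$. For an integer $d\ge1$ let $$\mathfrak N_{n,d}=\{(i,j)\in\{1,\dots,n\}^2:1\le j-i\le d\},\qquad \widetilde{\mathfrak N}_{n,d}=\{(i,j)\in\{1,\dots,n\}^2:i<j,\ i+j\le d\}.$$ For $1\le d\le d_{\max}-1$ define $X_{\mathrm{inv}}^{(d)}=\sum_{(i,j)\in\mathfrak N_{n,d}}\mathbf 1\{Z_i>Z_j\}$ on $S_n$; $X_{\mathrm{inv}}^{(d)}=\sum_{(i,j)\in\mathfrak N_{n,d}}\mathbf 1\{Z_i>Z_j\}+\sum_{(i,j)\in\widetilde{\mathfrak N}_{n,d}}\mathbf 1\{-Z_i>Z_j\}+\sum_{i=1}^{\min(n,d)}\mathbf 1\{Z_i<0\}$ on $B_n$; $X_{\mathrm{inv}}^{(d)}=\sum_{(i,j)\in\mathfrak N_{n,d}}\mathbf 1\{Z_i>Z_j\}+\sum_{(i,j)\in\widetilde{\mathfrak N}_{n,d+2}}\mathbf 1\{-Z_i>Z_j\}$ on $D_n$. *)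

(* Defs.v *)
From HB Require Import structures.
From mathcomp Require Import all_boot all_order all_algebra.
From mathcomp Require Import all_classical all_reals all_analysis.
From mathcomp Require Import measurable_realfun.

Set Implicit Arguments.
Unset Strict Implicit.
Unset Printing Implicit Defensive.

Import Order.TTheory GRing.Theory Num.Theory.
Import numFieldNormedType.Exports.
Local Open Scope classical_set_scope.
Local Open Scope ring_scope.

Definition alpha {R : realType} (k : nat) : R := (Num.sqrt (2 * ln k%:R))^-1.

Definition beta {R : realType} (k : nat) : R :=
  (alpha k)^-1 - 2^-1 * alpha k * (ln (ln k%:R) + ln (4 * pi)).

(* The type of a classical Weyl group: S_n, B_n or D_n. *)
Inductive weyl : Set := TypeS | TypeB | TypeD.

Definition dmax (W : weyl) (n : nat) : nat :=
  match W with
  | TypeS => n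
  | TypeB => 2 * n
  | TypeD => 2 * n - 2
  end.

Definition unif_lower {R : realType} (W : weyl) : R :=
  if W is TypeS then 0 else -1.

Lemma unif_lower_lt1 {R : realType} (W : weyl) : unif_lower W < 1 :> R.
Proof. by case: W => /=; rewrite ?ltr01// (lt_trans (ltrN10 R)) ?ltr01. Qed.

(* [uniform_prob] lives on the closed interval, which has the same law as the
   uniform distribution on the open one. *)
Definition unif_law {R : realType} (W : weyl) : set R -> \bar R :=
  uniform_prob (@unif_lower_lt1 R W).

(* The index i : 'I_n stands for the 1-based index i.+1; this only matters for
   [antidiag] and for the third sum in type B. *)
Definition band (n d : nat) : {set 'I_n * 'I_n} :=
  [set p : 'I_n * 'I_n | (p.1 < p.2)%N && (p.2 - p.1 <= d)%N].

Definition antidiag (n d : nat) : {set 'I_n * 'I_n} :=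
  [set p : 'I_n * 'I_n | (p.1 < p.2)%N && (p.1.+1 + p.2.+1 <= d)%N].

Section Xinv.
Context {disp : measure_display} {T : measurableType disp} {R : realType}.
Variables (W : weyl) (n d : nat) (Z : 'I_n -> {mfun T >-> R}).

Definition Xinv (t : T) : R :=
  match W with
  | TypeS => \sum_(p in band n d) (Z p.1 t > Z p.2 t)%R%:R
  | TypeB => \sum_(p in band n d) (Z p.1 t > Z p.2 t)%R%:R
           + \sum_(p in antidiag n d) (- Z p.1 t > Z p.2 t)%R%:R
           + \sum_(i < n | (i.+1 <= minn n d)%N) (Z i t < 0)%R%:R
  | TypeD => \sum_(p in band n d) (Z p.1 t > Z p.2 t)%R%:R
           + \sum_(p in antidiag n (d + 2)) (- Z p.1 t > Z p.2 t)%R%:R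
  end.

Let measurable_ind (f g : T -> R) : measurable_fun setT f ->
  measurable_fun setT g ->
  measurable_fun setT (fun t => (f t < g t)%R%:R : R).
Proof.
move=> mf mg; have mb : measurable_fun setT (fun t => (f t < g t)%R).
  exact: measurable_fun_ltr.
rewrite (_ : (fun t => _) = fun t => if (f t < g t)%R then 1 else 0 : R).
  exact: measurable_fun_ifT.
by apply/funext => t; case: ifP.
Qed.

Let measurable_sum_ind (I : finType) (A : pred I) (h : I -> T -> R) :
  (forall i, measurable_fun setT (h i)) ->
  measurable_fun setT (fun t => \sum_(i | A i) h i t).
Proof.
move=> mh; rewrite (_ : (fun t => _) =
    fun t => \sum_(i <- enum I) (if A i then h i t else 0)).
  by apply: measurable_sum => i; case: (A i).
by apply/funext => t; rewrite big_enum /= -big_mkcond.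
Qed.

Lemma measurable_Xinv : measurable_fun setT Xinv.
Proof.
have mN i : measurable_fun setT (fun t => - Z i t).
  exact: measurableT_comp.
rewrite /Xinv; case: W; do ?apply: measurable_funD;
  by apply: measurable_sum_ind => ?; apply: measurable_ind.
Qed.

HB.instance Definition _ :=
  isMeasurableFun.Build _ _ _ _ Xinv measurable_Xinv.

End Xinv.

Section iid.
Context {disp : measure_display} {T : measurableType disp} {R : realType}.
Variables (P : probability T R) (I : finType) (X : I -> {RV P >-> R}).

Definition mutually_independent : Prop :=
  forall (J : {set I}) (A : I -> set R), (forall i, measurable (A i)) ->
    P (\bigcap_(i in [set` J]) X i @^-1` A i)
    = (\prod_(i in J) P (X i @^-1` A i))%E.

Definition iid_with_law (mu : set R -> \bar R) : Prop :=
  mutually_independent /\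
  forall i (A : set R), measurable A -> distribution P (X i) A = mu A.

End iid.

(* The maximum of X 0, ..., X k.-1, meant for 0 < k. *)
Definition rowmax {T : Type} {R : realType} (k : nat) (X : nat -> T -> R)
    (t : T) : R :=
  \big[Num.max/X 0 t]_(j < k) X j t.

(* Main.v *)
Require Import Defs.
From HB Require Import structures.
From mathcomp Require Import all_boot all_order all_algebra.
From mathcomp Require Import all_classical all_reals all_analysis.
From mathcomp Require Import measurable_realfun.
From mathcomp Require Import ring lra zify.

(* The statistic is a sum of O(n d) bounded functions of pairs of coordinates,
   each of which shares a coordinate with only O(d) others, and its variance is
   at least of order n d.  Stein's method for this local dependence bounds
   E[W g(W)] - E[g'(W)] for the standardised statistic W by
   eps = O(d^{3/2} n^{-1/2}) times a local bound on g''.  With g exponential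
   this is a differential inequality for the moment generating function, so
   that E[e^{tW}] <= exp(t^2/2 + O(eps t^3)).  With g a Gaussian density it
   controls the derivative along the interpolation between W and a standard
   normal of the expectation of a Gaussian-smoothed indicator of (x, oo); all
   errors carry the factor exp(-x^2/2) because the second derivative of g is
   dominated by an exponential.  Smoothing at scale x^{-2} yields
   P(W > x) ~ P(N > x) as soon as x^7 eps -> 0, and x is of order
   sqrt(2 log k_n).  The theorem then follows from the classical Gaussian
   extreme value asymptotics.  The Stein identity and the variance bound are
   proved for a discretisation of the Z_i on a grid of 4m points, which is a
   finite product space, and pass to the limit m -> oo. *)

Set Implicit Arguments.
Unset Strict Implicit.
Unset Printing Implicit Defensive.

Import Order.TTheory GRing.Theory Num.Theory.
Import numFieldNormedType.Exports.
Local Open Scope classical_set_scope.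
Local Open Scope ring_scope.

(** * Averages over finite product spaces *)

(** The levels that matter have tail probability of order [1 / k_n], so only a relative error is of
    use there. With smoothing width [q] the interpolation costs about
    [eps (q^-3 + x^2 q^-1) exp(-x^2/2)]. The Gaussian tail changes by a constant factor when [x]
    moves by [1/x], so [q] must be small against [1/x]. The choice [q = x^-2] achieves this, and
    [eps x^6] against a tail of size [exp(-x^2/2) / x] is the relative error [x^7 eps]. Since
    [eps^2 x^14] is of order [(log k)^7 d^3 / n], this is where the exponents [1/7] and [3/7] of the
    theorem come from. The obstacle in the variance bound is that the linear projection of the
    statistic degenerates: away from the ends, the entry at [i] is compared with [d] later and [d]
    earlier entries, and the two conditional expectations given [Z_i] add up to a constant. A
    variance of order [n d] is visible only in genuine pair interactions, hence the test functions
    of two coordinates, centred in each. On a finite product space independence becomes a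
    rearrangement of finite sums. *)

Section product_space.
Context {R : realFieldType} {I A : finType}.
Hypothesis A_gt0 : (0 < #|A|)%N.
Implicit Types (S : {set I}) (F G : {ffun I -> A} -> R).

Definition avg F : R := #|{ffun I -> A}|%:R^-1 * \sum_c F c.

Definition depends_on S F :=
  forall c c' : {ffun I -> A}, (forall i, i \in S -> c i = c' i) -> F c = F c'.

Let card_neq0 : #|{ffun I -> A}|%:R != 0 :> R.
Proof. by rewrite pnatr_eq0 -lt0n card_ffun expn_gt0 A_gt0. Qed.

Lemma eq_avg F G : F =1 G -> avg F = avg G.
Proof. by move=> FG; rewrite /avg; congr (_ * _); apply: eq_bigr. Qed.

Lemma avgD F G : avg (fun c => F c + G c) = avg F + avg G.
Proof. by rewrite /avg big_split mulrDr. Qed.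

Lemma avgB F G : avg (fun c => F c - G c) = avg F - avg G.
Proof. by rewrite /avg sumrB mulrBr. Qed.

Lemma avgZ a F : avg (fun c => a * F c) = a * avg F.
Proof. by rewrite /avg -mulr_sumr mulrCA. Qed.

Lemma avg_cst a : avg (fun=> a) = a.
Proof.
by rewrite /avg sumr_const -[a *+ _]mulr_natr mulrCA mulVf ?mulr1.
Qed.

Lemma avg_sum (V : finType) (P : pred V) (F : V -> {ffun I -> A} -> R) :
  avg (fun c => \sum_(v | P v) F v c) = \sum_(v | P v) avg (F v).
Proof. by rewrite /avg exchange_big /= mulr_sumr. Qed.

Lemma le_avg F G : (forall c, F c <= G c) -> avg F <= avg G.
Proof. by move=> FG; rewrite ler_wpM2l ?invr_ge0 ?ler0n ?ler_sum. Qed.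

Lemma ler_norm_avg F : `|avg F| <= avg (fun c => `|F c|).
Proof.
rewrite /avg normrM ger0_norm ?invr_ge0 ?ler0n// ler_wpM2l ?invr_ge0//.
exact: ler_norm_sum.
Qed.

Lemma depends_onS S S' F : S \subset S' -> depends_on S F -> depends_on S' F.
Proof. by move=> SS' FS c c' cc'; apply: FS => i /(fintype.subsetP SS')/cc'. Qed.

Lemma depends_on_comp S F (h : R -> R) :
  depends_on S F -> depends_on S (fun c => h (F c)).
Proof. by move=> FS c c' /FS ->. Qed.

Lemma depends_on_op S S' F G (op : R -> R -> R) :
  depends_on S F -> depends_on S' G ->
  depends_on (S :|: S') (fun c => op (F c) (G c)).
Proof.
move=> FS GS c c' cc'; rewrite (FS c c') ?(GS c c')// => i Si;
  by apply: cc'; rewrite inE Si ?orbT.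
Qed.

Lemma depends_on_sum S (V : finType) (P : pred V) (F : V -> {ffun I -> A} -> R) :
  (forall v, P v -> depends_on S (F v)) ->
  depends_on S (fun c => \sum_(v | P v) F v c).
Proof. by move=> FS c c' cc'; apply: eq_bigr => v Pv; apply: FS. Qed.

(* Exchanging the coordinates outside [S] of two independent copies [c], [c']
   is a measure-preserving involution that turns [F c * G c'] into
   [F c * G c]. *)
Lemma avgM_indep S F G : depends_on S F -> depends_on (~: S) G ->
  avg (fun c => F c * G c) = avg F * avg G.
Proof.
move=> FS GS; pose mix (c c' : {ffun I -> A}) :=
  [ffun i => if i \in S then c i else c' i].
pose swap (p : {ffun I -> A} * {ffun I -> A}) := (mix p.1 p.2, mix p.2 p.1).
have swapK : involutive swap.
  move=> [c c']; rewrite /swap /=; congr (_, _); apply/ffunP => i;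
    by rewrite !ffunE; case: (i \in S).
have key : \sum_(p : {ffun I -> A} * {ffun I -> A}) F p.1 * G p.2
         = \sum_(p : {ffun I -> A} * {ffun I -> A}) F p.1 * G p.1.
  rewrite [RHS](reindex_inj (inv_inj swapK)) /=; apply: eq_bigr => -[c c'] _ /=.
  congr (_ * _).
    by apply: FS => i Si; rewrite ffunE Si.
  by apply: GS => i; rewrite inE ffunE => /negbTE ->.
have <- : avg (fun c => avg (fun=> F c * G c)) = avg (fun c => F c * G c).
  by apply: eq_avg => c; rewrite avg_cst.
transitivity (avg (fun c => avg (fun c' => F c * G c'))).
  rewrite /avg -!mulr_sumr; congr (_ * (_ * _)).
  rewrite (pair_bigA _ (fun c c' => F c * G c)).
  by rewrite (pair_bigA _ (fun c c' => F c * G c')) /= key.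
under eq_avg do rewrite avgZ mulrC.
by rewrite avgZ mulrC.
Qed.

End product_space.

(** * Stein's method for sums of bounded, locally dependent terms *)

Section local_dependence.
Context {R : realFieldType} {I A V : finType}.
Hypothesis A_gt0 : (0 < #|A|)%N.
Variables (Act : {set V}) (f : V -> {ffun I -> A} -> R) (S : V -> {set I}).
Variable D : nat.
Hypothesis f_bound : forall v c, 0 <= f v c <= 2.
Hypothesis f_dep : forall v, depends_on (S v) (f v).

Definition neighbours (v : V) : {set V} :=
  [set u in Act | ~~ [disjoint S u & S v]].

Hypothesis nb_card : forall v, v \in Act -> (#|neighbours v| <= D)%N.

Let X c := \sum_(v in Act) f v c.
Let mu := avg X.
Let fc v c := f v c - avg (f v).
Let part (U : {set V}) c := \sum_(v in U) f v c.

Let le_part (U : {set V}) m c : (#|U| <= m)%N -> `|part U c| <= 2 * m%:R.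
Proof.
move=> Um; rewrite ger0_norm; last first.
  by apply: sumr_ge0 => v _; case/andP: (f_bound v c).
apply: (@le_trans _ _ (\sum_(v in U) 2)).
  by apply: ler_sum => v _; case/andP: (f_bound v c).
by rewrite sumr_const -[_ *+ _]mulr_natr ler_wpM2l ?ler_nat.
Qed.

Let avg_f_bound v : 0 <= avg (f v) <= 2.
Proof.
apply/andP; split.
  rewrite -[leLHS](@avg_cst R I A A_gt0 0); apply: le_avg => c.
  by case/andP: (f_bound v c).
rewrite -[leRHS](@avg_cst R I A A_gt0 2); apply: le_avg => c.
by case/andP: (f_bound v c).
Qed.

Let fc_bound v c : `|fc v c| <= 2.
Proof.
have /andP[f0 f2] := f_bound v c; have /andP[a0 a2] := avg_f_bound v.
by rewrite /fc ler_norml; lra.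
Qed.

Let avg_fc v : avg (fc v) = 0.
Proof. by rewrite avgB avg_cst// subrr. Qed.

Let fc_dep v : depends_on (S v) (fc v).
Proof. exact: (depends_on_comp (fun x => x - avg (f v))). Qed.

Let rest_dep (U : {set V}) v : neighbours v \subset U ->
  depends_on (~: S v) (fun c => X c - part (Act :&: U) c).
Proof.
move=> nbU.
have -> : (fun c => X c - part (Act :&: U) c)
        = (fun c => \sum_(u in Act :\: U) f u c).
  by apply/funext => c; rewrite /X (big_setID U) /= addrAC subrr add0r.
apply: depends_on_sum => u; rewrite inE => /andP[uU uA].
apply: (depends_onS _ (@f_dep u)); rewrite -finset.disjoints_subset.
apply: contraR uU => dis; apply: (fintype.subsetP nbU).
by rewrite inE uA.
Qed.

Let nbS v : neighbours v \subset Act.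
Proof. by apply/fintype.subsetP => u; rewrite inE => /andP[]. Qed.

Let sum_fc c : \sum_(v in Act) fc v c = X c - mu.
Proof. by rewrite sumrB /mu /X avg_sum. Qed.

Let avg_fcX v : avg (fun c => fc v c * X c)
  = \sum_(u in neighbours v) avg (fun c => fc v c * f u c).
Proof.
under eq_avg do rewrite /X mulr_sumr.
rewrite avg_sum (big_setID (neighbours v)) /= (finset.setIidPr (nbS v)).
rewrite [X in _ + X]big1 ?addr0// => u; rewrite !inE => /andP[+ uA].
rewrite uA /= negbK => dis.
rewrite (avgM_indep A_gt0 (S := S v)) ?avg_fc ?mul0r//.
by apply: (depends_onS _ (@f_dep u)); rewrite -finset.disjoints_subset.
Qed.

Variables (g g1 B : R -> R).
(** The radius is the most that the sum can move when the neighbourhoods of two terms are removed: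
    at most [2 * D] terms, each at most 2. Asking for increments rather than derivatives keeps the
    statement algebraic, over any real field. *)
Hypothesis g_taylor : forall w a, `|a| <= 4 * D%:R ->
  `|g (w + a) - g w - a * g1 w| <= a ^+ 2 * B w
  /\ `|g1 (w + a) - g1 w| <= `|a| * B w.

(** For [D = 0] the hypothesis [g_taylor] only sees [a = 0] and leaves the sign of [B] free; this is
    why that case is treated apart below. *)
Let B_ge0 w : 0 < D%:R :> R -> 0 <= B w.
Proof.
move=> D0; have [|_] := g_taylor w (a := D%:R).
  by rewrite ger0_norm ?ler0n//; lra.
rewrite (ger0_norm (ltW D0)) => /(le_trans (normr_ge0 _)).
by rewrite pmulr_rge0.
Qed.

(** Without the neighbours of [v] the sum is independent of the centred [fc v], so that [g] at the
    reduced sum contributes nothing. What remains is a Taylor remainder, at most [(2 D)^2 B], times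
    [|fc v| <= 2]. *)
Let stein_first v : v \in Act ->
  `|avg (fun c => fc v c * g (X c))
    - avg (fun c => fc v c * part (neighbours v) c * g1 (X c))|
  <= 8 * D%:R ^+ 2 * avg (fun c => B (X c)).
Proof.
move=> vA; set T := part (neighbours v).
have z : avg (fun c => fc v c * g (X c - T c)) = 0.
  rewrite (avgM_indep A_gt0 (S := S v)) ?avg_fc ?mul0r//.
  apply: depends_on_comp; have := rest_dep (subxx (neighbours v)).
  by rewrite (finset.setIidPr (nbS v)).
rewrite -[X in `|X - _|]subr0 -{1}z -!avgB.
apply: le_trans (ler_norm_avg _) _; rewrite -avgZ; apply: le_avg => c.
have -> : fc v c * g (X c) - fc v c * g (X c - T c) - fc v c * T c * g1 (X c)
  = - fc v c * (g (X c + - T c) - g (X c) - (- T c) * g1 (X c)) by ring.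
have T2D : `|T c| <= 2 * D%:R by apply: le_part; exact: nb_card.
have D0 : 0 <= D%:R :> R by [].
have [|tay _] := g_taylor (X c) (a := - T c).
  by rewrite normrN (le_trans T2D)//; lra.
rewrite normrM normrN.
apply: le_trans (ler_pM (normr_ge0 _) (normr_ge0 _) (fc_bound v c) tay) _.
have Tsq : T c ^+ 2 <= 4 * D%:R ^+ 2.
  rewrite -real_normK ?num_real// (_ : 4 * _ = (2 * D%:R) ^+ 2); last by ring.
  by rewrite lerXn2r ?nnegrE//; lra.
rewrite sqrrN (_ : 8 * _ * _ = 2 * (4 * D%:R ^+ 2 * B (X c))); last by ring.
rewrite ler_wpM2l//.
(* If [D = 0], the removed part [T c] vanishes and the sign of [B] does not matter. *)
move: D0; rewrite le_eqVlt => /orP[/eqP D0|D0].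
  have -> : T c = 0.
    by apply/eqP; move: T2D; rewrite -D0 mulr0 normr_le0.
  by rewrite -D0 expr0n /= mulr0 !mul0r.
by rewrite ler_wpM2r ?B_ge0.
Qed.

(** Removing the neighbours of both [u] and [v] makes [g1] independent of the product of the two
    terms. This replacement is made twice, in the joint average and in the product of averages; each
    time it costs at most [4 D B] times the bound 4 on the product. *)
Let stein_second v u : v \in Act -> u \in neighbours v ->
  `|avg (fun c => fc v c * f u c * g1 (X c))
    - avg (fun c => fc v c * f u c) * avg (fun c => g1 (X c))|
  <= 32 * D%:R * avg (fun c => B (X c)).
Proof.
move=> vA uv; have uA : u \in Act by exact: (fintype.subsetP (nbS v)).
have D0 : (0 < D)%N.
  by apply: leq_trans (nb_card vA); apply/card_gt0P; exists u.
set U := neighbours v :|: neighbours u; set T := part (Act :&: U).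
have T4D c : `|T c| <= 4 * D%:R.
  rewrite (_ : 4 * _ = 2 * (D + D)%:R); last by rewrite natrD; ring.
  apply: le_part; apply: leq_trans (subset_leq_card (finset.subsetIr _ _)) _.
  apply: leq_trans (leq_add (nb_card vA) (nb_card uA)).
  by rewrite cardsU leq_subr.
have fcf c : `|fc v c * f u c| <= 4.
  rewrite normrM (_ : 4 = 2 * 2); last by ring.
  rewrite ler_pM ?fc_bound//.
  by have /andP[f0 f2] := f_bound u c; rewrite ger0_norm.
have ind : avg (fun c => fc v c * f u c * g1 (X c - T c))
         = avg (fun c => fc v c * f u c) * avg (fun c => g1 (X c - T c)).
  apply: (avgM_indep A_gt0 (S := S v :|: S u)).
    exact: depends_on_op.
  apply: depends_on_comp => c c' cc'.
  have -> : (X c - T c) = \sum_(w in Act :\: U) f w c.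
    by rewrite /X (big_setID U) /= addrAC subrr add0r.
  have -> : (X c' - T c') = \sum_(w in Act :\: U) f w c'.
    by rewrite /X (big_setID U) /= addrAC subrr add0r.
  apply: eq_bigr => w; rewrite !inE negb_or => /andP[+ wA].
  rewrite wA /= !negbK => /andP[wv wu]; apply: f_dep => i Si; apply: cc'.
  by rewrite !inE negb_or (disjointFr wv Si) (disjointFr wu Si).
have dg c : `|g1 (X c) - g1 (X c - T c)| <= 4 * D%:R * B (X c).
  have [|_] := g_taylor (X c) (a := - T c); first by rewrite normrN.
  rewrite normrN distrC => /le_trans; apply.
  by rewrite ler_wpM2r ?T4D// B_ge0// ltr0n.
have -> : avg (fun c => fc v c * f u c * g1 (X c))
    - avg (fun c => fc v c * f u c) * avg (fun c => g1 (X c))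
  = avg (fun c => fc v c * f u c * (g1 (X c) - g1 (X c - T c)))
    - avg (fun c => fc v c * f u c) * avg (fun c => g1 (X c) - g1 (X c - T c)).
  have -> : avg (fun c => fc v c * f u c * (g1 (X c) - g1 (X c - T c))) =
      avg (fun c => fc v c * f u c * g1 (X c))
      - avg (fun c => fc v c * f u c * g1 (X c - T c)).
    by rewrite -avgB; apply: eq_avg => c; rewrite mulrBr.
  rewrite ind (_ : avg (fun c => g1 (X c) - g1 (X c - T c)) =
    avg (fun c => g1 (X c)) - avg (fun c => g1 (X c - T c))); last exact: avgB.
  ring.
apply: le_trans (ler_normB _ _) _.
have -> : 32 * D%:R * avg (fun c => B (X c)) =
  avg (fun c => 4 * (4 * D%:R * B (X c))) + 4 * avg (fun c => 4 * D%:R * B (X c)).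
  by rewrite !avgZ; ring.
apply: lerD.
  apply: le_trans (ler_norm_avg _) _; apply: le_avg => c.
  by rewrite normrM ler_pM.
rewrite normrM ler_pM//.
  apply: le_trans (ler_norm_avg _) _.
  by rewrite -[leRHS](@avg_cst R I A A_gt0 4); exact: le_avg.
by apply: le_trans (ler_norm_avg _) _; exact: le_avg.
Qed.

(** By independence the variance is the sum of the covariances over neighbouring pairs, so it splits
    along the same double sum as the first order terms. Each [v] contributes [8 D^2] from
    [stein_first] and at most [D] times [32 D] from [stein_second]. *)
Lemma stein_local_dependence (Y : {ffun I -> A} -> R) :
  (forall c, Y c = \sum_(v in Act) f v c) ->
  `|avg (fun c => (Y c - avg Y) * g (Y c))
    - avg (fun c => (Y c - avg Y) ^+ 2) * avg (fun c => g1 (Y c))|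
  <= 40 * #|Act|%:R * D%:R ^+ 2 * avg (fun c => B (Y c)).
Proof.
move=> YX; have -> : Y = X by exact/funext.
rewrite -/mu.
have -> : avg (fun c => (X c - mu) * g (X c))
        = \sum_(v in Act) avg (fun c => fc v c * g (X c)).
  by rewrite -avg_sum; apply: eq_avg => c; rewrite -sum_fc mulr_suml.
have -> : avg (fun c => (X c - mu) ^+ 2) = \sum_(v in Act)
    \sum_(u in neighbours v) avg (fun c => fc v c * f u c).
  under eq_bigr do rewrite -avg_fcX.
  rewrite -avg_sum.
  under [RHS]eq_avg do rewrite -mulr_suml sum_fc.
  have -> : avg (fun c => (X c - mu) * X c)
          = avg (fun c => (X c - mu) ^+ 2 + mu * (X c - mu)).
    by apply: eq_avg => c; ring.
  by rewrite avgD avgZ avgB avg_cst// subrr mulr0 addr0.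
rewrite mulr_suml -sumrB.
apply: le_trans (ler_norm_sum _ _ _) _.
rewrite (_ : 40 * _ * _ * _ =
    \sum_(v in Act) 40 * D%:R ^+ 2 * avg (fun c => B (X c))); last first.
  by rewrite sumr_const -[_ *+ _]mulr_natr; ring.
apply: ler_sum => v vA; rewrite mulr_suml.
rewrite -[X in `|X|](subrKA (avg (fun c => fc v c * part (neighbours v) c * g1 (X c)))).
apply: le_trans (ler_normD _ _) _.
have -> : 40 * D%:R ^+ 2 * avg (fun c => B (X c)) =
    8 * D%:R ^+ 2 * avg (fun c => B (X c))
    + 32 * D%:R ^+ 2 * avg (fun c => B (X c)) by ring.
apply: lerD; first exact: stein_first.
have -> : avg (fun c => fc v c * part (neighbours v) c * g1 (X c))
  = \sum_(u in neighbours v) avg (fun c => fc v c * f u c * g1 (X c)).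
  by rewrite -avg_sum; apply: eq_avg => c; rewrite mulr_sumr mulr_suml.
rewrite -sumrB; apply: le_trans (ler_norm_sum _ _ _) _.
apply: le_trans (ler_sum _ (fun u uv => stein_second vA uv)) _.
rewrite sumr_const -[_ *+ _]mulr_natr.
have [D0|D0] := posnP D.
  have := nb_card vA; rewrite D0 leqn0 => /eqP ->.
  by rewrite mulr0 expr0n /= mulr0 mul0r.
rewrite (_ : 32 * D%:R ^+ 2 * _ =
  32 * D%:R * avg (fun c => B (X c)) * D%:R); last by ring.
rewrite ler_wpM2l ?ler_nat ?nb_card//; apply: mulr_ge0; first by rewrite mulr_ge0.
rewrite -[leLHS](@avg_cst R I A A_gt0 0); apply: le_avg => c.
by rewrite B_ge0 ?ltr0n.
Qed.

End local_dependence.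

(** * Inversion counts *)

Section inversion_count.
Local Open Scope nat_scope.
Variables (W : weyl) (n d : nat).

Definition anti_pairs : {set 'I_n * 'I_n} :=
  match W with
  | TypeS => finset.set0
  | TypeB => antidiag n d
  | TypeD => antidiag n (d + 2)
  end.

Definition sign_indices : {set 'I_n} :=
  if W is TypeB then [set i : 'I_n | i.+1 <= minn n d] else finset.set0.

(** The three comparisons are parameters so that the same count applies to the real variables and to
    their grid indices, for all three types at once. *)
Definition inv_count (G H : 'I_n -> 'I_n -> bool) (N : 'I_n -> bool) : nat :=
  \sum_(p in band n d) G p.1 p.2 + \sum_(p in anti_pairs) H p.1 p.2
  + \sum_(i in sign_indices) N i.

(** The common index set of all terms. The diagonal is included to carry the sign indicators of type
    B. The antidiagonal pairs fit in as well, because a small sum of indices forces a small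
    difference. *)
Definition near_pairs : {set 'I_n * 'I_n} :=
  [set p : 'I_n * 'I_n | (p.1 <= p.2) && (p.2 - p.1 <= d)].

Definition inv_term (G H : 'I_n -> 'I_n -> bool) (N : 'I_n -> bool)
    (p : 'I_n * 'I_n) : nat :=
  (p \in band n d) && G p.1 p.2 + (p \in anti_pairs) && H p.1 p.2
  + ((p.1 == p.2) && (p.1 \in sign_indices)) && N p.1.

Lemma band_near p : p \in band n d -> p \in near_pairs.
Proof. by rewrite !inE => /andP[/ltnW -> ->]. Qed.

Lemma anti_near p : p \in anti_pairs -> p \in near_pairs.
Proof.
rewrite /anti_pairs /near_pairs; case: W; rewrite !inE// => /andP[lt le]; lia.
Qed.

Lemma inv_termE G H N : inv_count G H N = \sum_(p in near_pairs) inv_term G H N p.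
Proof.
rewrite /inv_term !big_split /=; congr (_ + _ + _).
- rewrite [RHS](bigID (mem (band n d))) /= [X in _ = _ + X]big1 ?addn0; last first.
    by move=> p /andP[_ /negbTE ->].
  apply: eq_big => [p|p ->] //.
  by case: (boolP (p \in band n d)) => [/band_near ->|]; rewrite ?andbF.
- rewrite [RHS](bigID (mem anti_pairs)) /= [X in _ = _ + X]big1 ?addn0; last first.
    by move=> p /andP[_ /negbTE ->].
  apply: eq_big => [p|p ->] //.
  by case: (boolP (p \in anti_pairs)) => [/anti_near ->|]; rewrite ?andbF.
rewrite [RHS](bigID (fun p : 'I_n * 'I_n => (p.1 == p.2) && (p.1 \in sign_indices))) /=.
rewrite [X in _ = _ + X]big1 ?addn0; last first.
  by move=> p /andP[_ /negbTE ->].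
rewrite (reindex_onto (fun i => (i, i)) fst) /=; last first.
  by move=> [i j] /= /andP[_ /andP[/eqP ->]].
apply: eq_big => [i|i ->]; rewrite ?eqxx//.
by rewrite inE /= leqnn subnn /= andbT.
Qed.

(** A diagonal pair carries only the sign term, and any other pair only the first two. *)
Lemma inv_term_le2 G H N p : inv_term G H N p <= 2.
Proof.
rewrite /inv_term; case: (boolP (p.1 == p.2)) => [/eqP E|_] /=.
  have -> : (p \in band n d) = false by rewrite inE E ltnn.
  have -> : (p \in anti_pairs) = false.
    by rewrite /anti_pairs; case: W; rewrite !inE ?E ?ltnn.
  by rewrite /=; case: (_ && _).
by rewrite addn0; case: (_ && _); case: (_ && _).
Qed.

Lemma inv_count_le G H N : inv_count G H N <= 2 * n ^ 2.
Proof.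
rewrite inv_termE (leq_trans (leq_sum _ (fun p _ => inv_term_le2 G H N p)))//.
rewrite sum_nat_const mulnC leq_mul2l /= (leq_trans (max_card _))//.
by rewrite card_prod card_ord -mulnn.
Qed.

Let diff (p : 'I_n * 'I_n) : 'I_d.+1 := inord (p.2 - p.1).

Let diffE p : p \in near_pairs -> diff p = p.2 - p.1 :> nat.
Proof. by rewrite inE => /andP[_ le]; rewrite /diff inordK ?ltnS. Qed.

Lemma card_near_pairs : #|near_pairs| <= n * d.+1.
Proof.
have <- : #|(fun p => (p.1, diff p)) @: near_pairs| = #|near_pairs|.
  apply: card_in_imset => p q pin qin [E1 E2].
  have := diffE pin; have := diffE qin; move: pin qin E1 E2.
  rewrite !inE => /andP[p1 p2] /andP[q1 q2] E1 -> -> E3.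
  rewrite [p]surjective_pairing [q]surjective_pairing E1; congr (_, _).
  apply: ord_inj; move: p1 q1 E3; rewrite E1 => p1 q1 E3.
  by rewrite -(subnK p1) -(subnK q1) E3.
by rewrite (leq_trans (max_card _))// card_prod !card_ord.
Qed.

Lemma card_near_fst i : #|[set p in near_pairs | p.1 == i]%SET| <= d.+1.
Proof.
have <- : #|diff @: [set p in near_pairs | p.1 == i]%SET|
        = #|[set p in near_pairs | p.1 == i]%SET|.
  apply: card_in_imset => p q; rewrite inE => /andP[pin /eqP pi].
  rewrite inE => /andP[qin /eqP qi] E2.
  have := diffE pin; have := diffE qin; rewrite E2; move: pin qin.
  rewrite !inE => /andP[p1 p2] /andP[q1 q2] -> E3.
  rewrite [p]surjective_pairing [q]surjective_pairing pi qi; congr (_, _).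
  apply: ord_inj; move: p1 q1 E3; rewrite pi qi => p1 q1 E3.
  by rewrite -(subnK p1) -(subnK q1) E3.
by rewrite (leq_trans (max_card _))// card_ord.
Qed.

Lemma card_near_snd i : #|[set p in near_pairs | p.2 == i]%SET| <= d.+1.
Proof.
have <- : #|diff @: [set p in near_pairs | p.2 == i]%SET|
        = #|[set p in near_pairs | p.2 == i]%SET|.
  apply: card_in_imset => p q; rewrite inE => /andP[pin /eqP pi].
  rewrite inE => /andP[qin /eqP qi] E2.
  have := diffE pin; have := diffE qin; rewrite E2; move: pin qin.
  rewrite !inE => /andP[p1 p2] /andP[q1 q2] -> E3.
  rewrite [p]surjective_pairing [q]surjective_pairing pi qi; congr (_, _).
  apply: ord_inj; move: p1 q1 E3; rewrite pi qi => p1 q1 E3.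
  by rewrite -(subKn p1) -(subKn q1) E3.
by rewrite (leq_trans (max_card _))// card_ord.
Qed.

(** A shared coordinate is the first or second entry of [q] and the first or second entry of [p];
    each of these four cases leaves at most [d.+1] choices. *)
Lemma card_near_neighbours p : #|neighbours near_pairs
  (fun p : 'I_n * 'I_n => [set p.1; p.2]%SET) p| <= 4 * d.+1.
Proof.
set N := neighbours _ _ _.
have sub : N \subset
    ([set q in near_pairs | q.1 == p.1]%SET :|: [set q in near_pairs | q.2 == p.1]%SET)
    :|: ([set q in near_pairs | q.1 == p.2]%SET :|: [set q in near_pairs | q.2 == p.2]%SET).
  apply/fintype.subsetP => q; rewrite /N /neighbours !inE => /andP[-> /=].
  apply: contraR; rewrite !negb_or => /andP[/andP[n1 n2] /andP[n3 n4]].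
  rewrite disjoint_sym; apply/pred0P => i /=; rewrite !inE.
  apply/negP => /andP[/orP[]/eqP -> /orP[]/eqP E].
  - by rewrite E eqxx in n1.
  - by rewrite E eqxx in n2.
  - by rewrite E eqxx in n3.
  - by rewrite E eqxx in n4.
apply: leq_trans (subset_leq_card sub) _.
rewrite (_ : 4 * d.+1 = (d.+1 + d.+1) + (d.+1 + d.+1)); last by lia.
do 2?[apply: leq_trans (leq_card_setU _ _) _; apply: leq_add];
  by rewrite ?card_near_fst ?card_near_snd.
Qed.

End inversion_count.

Section coordinate_averages.
Context {R : realFieldType} {I A : finType}.
Hypothesis A_gt0 : (0 < #|A|)%N.

Lemma avg_coord (i : I) (phi : A -> R) :
  avg (fun c : {ffun I -> A} => phi (c i)) = #|A|%:R^-1 * \sum_a phi a.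
Proof.
have An0 : #|A|%:R != 0 :> R by rewrite pnatr_eq0 -lt0n.
rewrite /avg; pose F k a : R := if k == i then phi a else 1.
transitivity (#|{ffun I -> A}|%:R^-1 * \sum_(c : {ffun I -> A}) \prod_k F k (c k)).
  congr (_ * _); apply: eq_bigr => c _.
  rewrite (bigD1 i)//= /F eqxx big1 ?mulr1// => k /negbTE ->.
  by [].
rewrite -(bigA_distr_bigA F) (bigD1 i)//= {1}/F eqxx.
have -> : \prod_(k | k != i) \sum_(a : A) F k a = #|A|%:R ^+ (#|I|.-1).
  rewrite -(cardC1 i) -prodr_const; apply: eq_bigr => k /negbTE ki.
  by rewrite /F ki sumr_const.
rewrite card_ffun natrX; have : (0 < #|I|)%N by apply/card_gt0P; exists i.
case: #|I| => [//|N] _ /=; rewrite exprS.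
by field; rewrite ?expf_neq0 ?An0.
Qed.

Lemma avg_coord2 (i j : I) (phi : A -> A -> R) : i != j ->
  avg (fun c : {ffun I -> A} => phi (c i) (c j))
  = #|A|%:R^-1 ^+ 2 * \sum_a \sum_b phi a b.
Proof.
move=> ij.
have -> : avg (fun c : {ffun I -> A} => phi (c i) (c j))
    = avg (fun c : {ffun I -> A} => \sum_a (c i == a)%:R * phi a (c j)).
  apply: eq_avg => c; rewrite (bigD1 (c i))//= eqxx mul1r big1 ?addr0// => a.
  by rewrite eq_sym => /negbTE ->; rewrite mul0r.
rewrite avg_sum mulr_sumr; apply: eq_bigr => a _.
rewrite (avgM_indep A_gt0 (S := [set i]%SET)).
- rewrite (avg_coord i (fun b => (b == a)%:R)) (avg_coord j (phi a)).
  rewrite (bigD1 a)//= eqxx big1 ?addr0; last by move=> b /negbTE ->.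
  by rewrite mulr1 expr2 mulrA.
- by move=> c c' cc'; rewrite (cc' i)// inE.
- by move=> c c' cc'; rewrite (cc' j)// !inE eq_sym.
Qed.

End coordinate_averages.

(** * Sign patterns on the grid that detect inversions *)

Section quarters.
Variable m : nat.
Local Open Scope nat_scope.

(* Two sign patterns on the four quarters of [{0, ..., 4m - 1}]: (-,-,+,+) and
   (+,-,-,+).  The product of the first at [a] with the second at [b]
   correlates with the event [b < a]. *)
Definition half_sign (a : nat) : int := if a < 2 * m then (-1)%R else 1%R.
Definition outer_sign (b : nat) : int :=
  if (b < m) || (3 * m <= b) then 1%R else (-1)%R.

Let part_sum (a : nat) : int :=
  if a <= m then a%:Z else if a <= 3 * m then ((2 * m)%:Z - a%:Z)%R
  else (a%:Z - (4 * m)%:Z)%R.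

Let sum_outer a : a <= 4 * m -> (\sum_(b < a) outer_sign b = part_sum a)%R.
Proof.
elim: a => [|a IH] le; first by rewrite big_ord0.
rewrite big_ord_recr /= IH; last exact: ltnW.
rewrite /part_sum /outer_sign; do ![case: ifP => ?]; lia.
Qed.

(** The sum is doubled so that the closed form has integer coefficients; on each quarter it sums a
    constant sign times a linear piece of [part_sum]. *)
Let sum_half N : N <= 4 * m ->
  (2 * \sum_(a < N) half_sign a * part_sum a =
   if (N <= m)%N then - N%:Z * (N%:Z - 1)
   else if (N <= 2 * m)%N then (N%:Z - (2 * m)%:Z) * (N%:Z - (2 * m)%:Z - 1) - 2 * m%:Z ^+ 2
   else if (N <= 3 * m)%N then - (N%:Z - (2 * m)%:Z) * (N%:Z - (2 * m)%:Z - 1) - 2 * m%:Z ^+ 2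
   else ((4 * m)%:Z - N%:Z) * ((4 * m)%:Z - N%:Z + 1) - 4 * m%:Z ^+ 2)%R.
Proof.
elim: N => [|N IH] le; first by rewrite big_ord0 leq0n oppr0 mulr0 mul0r.
rewrite big_ord_recr /= mulrDr IH; last exact: ltnW.
rewrite /part_sum /half_sign; do ![case: ifP => ?]; nia.
Qed.

Lemma sum_half_sign : (\sum_(a < 4 * m) half_sign a = 0)%R.
Proof.
have key N : N <= 4 * m -> (\sum_(a < N) half_sign a =
    if (N <= 2 * m)%N then - N%:Z else N%:Z - (4 * m)%:Z)%R.
  elim: N => [|N IH] le; first by rewrite big_ord0.
  rewrite big_ord_recr /= IH; last exact: ltnW.
  by rewrite /half_sign; do ![case: ifP => ?]; lia.
by rewrite key//; case: ifP => ?; lia.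
Qed.

Lemma sum_outer_sign : (\sum_(b < 4 * m) outer_sign b = 0)%R.
Proof. by rewrite sum_outer// /part_sum; do ![case: ifP => ?]; lia. Qed.

(** Two different patterns are needed: if both factors were the same centred pattern, exchanging [a]
    and [b] would show that the sum is only of order [m], coming from the diagonal, instead of
    [m^2]. *)
Lemma sum_quarters :
  (\sum_(a < 4 * m) \sum_(b < 4 * m) (b < a)%N%:R * (half_sign a * outer_sign b)
   = - 2 * m%:Z ^+ 2)%R.
Proof.
transitivity (\sum_(a < 4 * m) half_sign a * part_sum a)%R.
  apply: eq_bigr => a _; rewrite -sum_outer; last exact: ltnW.
  rewrite mulr_sumr (big_ord_widen _ (fun b => half_sign a * outer_sign b)%R (ltnW (ltn_ord a))).
  rewrite [RHS]big_mkcond /=; apply: eq_bigr => b _.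
  by case: ltnP; rewrite ?mul1r ?mul0r.
have := sum_half (leqnn (4 * m)).
set t := (\sum_(a < _) _)%R; do ![case: ifP => ?]; nia.
Qed.

End quarters.

(** * Stein identity and variance bound on the grid *)

Section grid_model.
Context {R : realFieldType}.
Variables (W : weyl) (n d m : nat).
Hypothesis m_gt0 : (0 < m)%N.

(** For a uniform variable on [(-1, 1)] cut into [4 * m] cells, [Z_i + Z_j < 0] is certain when
    [c i + c j + 2 <= 4 * m] and impossible when [c i + c j >= 4 * m]. The value [(4 * m).-1] is the
    only undecided one and is not counted. The sign of [Z_i] is decided exactly by [c i < 2 * m]. *)
Definition grid_count (c : {ffun 'I_n -> 'I_(4 * m)}) : nat :=
  inv_count W d (fun i j => c j < c i)%N (fun i j => c i + c j < (4 * m).-1)%N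
    (fun i => c i < 2 * m)%N.

Let X c : R := (grid_count c)%:R.

Let A_gt0 : (0 < #|'I_(4 * m)|)%N.
Proof. by rewrite card_ord muln_gt0. Qed.

Let term (p : 'I_n * 'I_n) (c : {ffun 'I_n -> 'I_(4 * m)}) : R :=
  (inv_term W d (fun i j => c j < c i)%N (fun i j => c i + c j < (4 * m).-1)%N
    (fun i => c i < 2 * m)%N p)%:R.

Let S (p : 'I_n * 'I_n) : {set 'I_n} := [set p.1; p.2]%SET.

Let term_dep p : depends_on (S p) (term p).
Proof.
move=> c c' cc'; rewrite /term /inv_term (cc' p.1) ?(cc' p.2)//;
  by rewrite !inE eqxx ?orbT.
Qed.

Let countE c : (grid_count c)%:R = \sum_(p in near_pairs n d) term p c.
Proof. by rewrite /grid_count inv_termE natr_sum. Qed.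

(** Here [D = 4 * d.+1] and there are at most [n * d.+1] terms: the radius is [4 * D], and [640] is
    40 times the 16 from [D ^ 2]. *)
Lemma grid_stein (g g1 B : R -> R) :
  (forall x a, `|a| <= (16 * d.+1)%:R ->
    `|g (x + a) - g x - a * g1 x| <= a ^+ 2 * B x
    /\ `|g1 (x + a) - g1 x| <= `|a| * B x) ->
  `|avg (fun c => (X c - avg X) * g (X c))
    - avg (fun c => (X c - avg X) ^+ 2) * avg (fun c => g1 (X c))|
  <= (640 * n * d.+1 ^ 3)%:R * avg (fun c => B (X c)).
Proof.
move=> tay.
have B0 x : 0 <= B x.
  have [|_] := tay x 1; first by rewrite normr1 ler1n.
  by rewrite normr1 mul1r; exact: le_trans.
have avgB0 : 0 <= avg (fun c => B (X c)).
  by rewrite -[leLHS](@avg_cst R 'I_n 'I_(4 * m) A_gt0 0); apply: le_avg.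
have t2 p c : 0 <= term p c <= 2 by rewrite ler0n ler_nat inv_term_le2.
have nb p : p \in near_pairs n d ->
    (#|neighbours (near_pairs n d) S p| <= 4 * d.+1)%N.
  by move=> _; exact: card_near_neighbours.
have tay' x a : `|a| <= 4 * (4 * d.+1)%:R ->
    `|g (x + a) - g x - a * g1 x| <= a ^+ 2 * B x
    /\ `|g1 (x + a) - g1 x| <= `|a| * B x.
  by move=> le; apply: tay; move: le; rewrite !natrM; lra.
have := stein_local_dependence A_gt0 t2 term_dep nb tay'.
move=> /(_ X countE)/le_trans; apply.
rewrite ler_wpM2r// -natrX -!natrM ler_nat.
have := card_near_pairs n d; set N := #|_|; nia.
Qed.

Let half (c : {ffun 'I_n -> 'I_(4 * m)}) (i : 'I_n) : R := (half_sign m (c i))%:~R.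
Let outer (c : {ffun 'I_n -> 'I_(4 * m)}) (i : 'I_n) : R := (outer_sign m (c i))%:~R.

Let half_sqr c i : half c i ^+ 2 = 1.
Proof. by rewrite /half /half_sign; case: ifP => _; rewrite ?sqrrN expr1n. Qed.

Let outer_sqr c i : outer c i ^+ 2 = 1.
Proof. by rewrite /outer /outer_sign; case: ifP => _; rewrite ?sqrrN expr1n. Qed.

Let avg_half i : avg (half ^~ i) = 0.
Proof.
rewrite (avg_coord A_gt0 i (fun a : 'I_(4 * m) => (half_sign m a)%:~R)).
by rewrite -raddf_sum /= sum_half_sign mulr0.
Qed.

Let avg_outer i : avg (outer ^~ i) = 0.
Proof.
rewrite (avg_coord A_gt0 i (fun a : 'I_(4 * m) => (outer_sign m a)%:~R)).
by rewrite -raddf_sum /= sum_outer_sign mulr0.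
Qed.

Let kern (p : 'I_n * 'I_n) c : R := half c p.1 * outer c p.2.

Let half_dep i : depends_on [set i]%SET (half ^~ i).
Proof. by move=> c c' cc'; rewrite /half cc'// inE. Qed.

Let outer_dep i : depends_on [set i]%SET (outer ^~ i).
Proof. by move=> c c' cc'; rewrite /outer cc'// inE. Qed.

(* The pairs outside the corner where the antidiagonal terms live. *)
Let Q : {set 'I_n * 'I_n} := [set p : 'I_n * 'I_n | (p \in band n d) && (d <= p.1)%N].

Let QP p : p \in Q -> [/\ p \in band n d, (p.1 < p.2)%N & p \notin anti_pairs W n d].
Proof.
rewrite inE => /andP[pb dp]; split=> //; first by move: pb; rewrite inE => /andP[].
move: pb; rewrite /anti_pairs; case: W; rewrite !inE// => /andP[lt le];
  by apply/negP => /andP[_]; lia.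
Qed.

(* [half] and [outer] are centred, so a term that misses a coordinate of [p]
   is uncorrelated with [kern p]. *)
Let avg_kernM p (F : {ffun 'I_n -> 'I_(4 * m)} -> R) (U : {set 'I_n}) :
  p.1 != p.2 -> depends_on U F -> ~~ ((p.1 \in U) && (p.2 \in U)) ->
  avg (fun c => F c * kern p c) = 0.
Proof.
move=> p12 FU; rewrite negb_and => /orP[pU|pU].
  have -> : avg (fun c => F c * kern p c) = avg (fun c => half c p.1 * (F c * outer c p.2)).
    by apply: eq_avg => c; rewrite /kern; ring.
  rewrite (avgM_indep A_gt0 (half_dep (i := p.1))) ?avg_half ?mul0r//.
  apply: (depends_onS _ (depends_on_op _ FU (outer_dep (i := p.2)))).
  apply/fintype.subsetP => i; rewrite !inE => /orP[iU|/eqP ->].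
    by apply: contraNneq pU => <-.
  by rewrite eq_sym.
have -> : avg (fun c => F c * kern p c) = avg (fun c => outer c p.2 * (F c * half c p.1)).
  by apply: eq_avg => c; rewrite /kern; ring.
rewrite (avgM_indep A_gt0 (outer_dep (i := p.2))) ?avg_outer ?mul0r//.
apply: (depends_onS _ (depends_on_op _ FU (half_dep (i := p.1)))).
apply/fintype.subsetP => i; rewrite !inE => /orP[iU|/eqP ->//].
by apply: contraNneq pU => <-.
Qed.

(** Near pairs are ordered, so [p] reversed is not among them. *)
Let in_QS p q : p \in Q -> q \in near_pairs n d ->
  (p.1 \in S q) && (p.2 \in S q) -> q = p.
Proof.
move=> /QP[_ p12 _]; rewrite !inE => /andP[q12 _].
move=> /andP[/orP[]/eqP E1 /orP[]/eqP E2]; move: p12; rewrite E1 E2 ?ltnn//.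
  by rewrite [q]surjective_pairing [p]surjective_pairing E1 E2.
by rewrite ltnNge q12.
Qed.

Let neqQ p : p \in Q -> p.1 != p.2.
Proof. by move=> /QP[_ lt _]; rewrite -val_eqE neq_ltn lt. Qed.

Let avg_termM p : p \in Q -> avg (fun c => term p c * kern p c) = - 8^-1.
Proof.
move=> pQ; have [pb lt pa] := QP pQ.
have -> : avg (fun c => term p c * kern p c) = avg (fun c : {ffun 'I_n -> 'I_(4 * m)} => (c p.2 < c p.1)%N%:R
    * ((half_sign m (c p.1))%:~R * (outer_sign m (c p.2))%:~R)).
  apply: eq_avg => c; congr (_ * _).
  rewrite /term /inv_term pb (negbTE pa) /= addn0.
  by rewrite (_ : p.1 == p.2 = false) ?addn0//; exact/negbTE/neqQ.
rewrite (avg_coord2 A_gt0 (fun a b : 'I_(4 * m) => (b < a)%N%:R *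
  ((half_sign m a)%:~R * (outer_sign m b)%:~R)) (neqQ pQ)).
have -> : \sum_(a < 4 * m) \sum_(b < 4 * m) (b < a)%N%:R *
    ((half_sign m a)%:~R * (outer_sign m b)%:~R)
  = (\sum_(a < 4 * m) \sum_(b < 4 * m) (b < a)%N%:R
      * (half_sign m a * outer_sign m b))%:~R :> R.
  rewrite raddf_sum; apply: eq_bigr => a _; rewrite raddf_sum.
  by apply: eq_bigr => b _; rewrite /= !rmorphM /=; case: (_ < _)%N.
rewrite sum_quarters card_ord natrM rmorphM rmorphXn /= rmorphN /=.
have m0 : m%:R != 0 :> R by rewrite pnatr_eq0 -lt0n.
by rewrite (_ : m%:~R = m%:R :> R)//; field.
Qed.

Let avg_X_kern p : p \in Q -> avg (fun c => X c * kern p c) = - 8^-1.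
Proof.
move=> pQ; rewrite -(avg_termM pQ).
have -> : avg (fun c => X c * kern p c)
    = avg (fun c => \sum_(q in near_pairs n d) term q c * kern p c).
  by apply: eq_avg => c; rewrite /X countE mulr_suml.
rewrite avg_sum (bigD1 p) /=; last first.
  by have [pb _ _] := QP pQ; exact: band_near.
rewrite big1 ?addr0// => q /andP[qn qp].
apply: (avg_kernM (neqQ pQ) (term_dep (p := q))).
by apply: contra qp => pS; apply/eqP; exact: in_QS pS.
Qed.

Let avg_kern p : p \in Q -> avg (kern p) = 0.
Proof.
move=> pQ; have := @avg_kernM p (fun=> 1) finset.set0 (neqQ pQ).
have -> : avg (fun c => 1 * kern p c) = avg (kern p).
  by apply: eq_avg => c; rewrite mul1r.
by apply => //; rewrite inE.
Qed.

Let kern_dep p : depends_on (S p) (kern p).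
Proof. exact: depends_on_op. Qed.

(** The kernels are orthonormal: distinct pairs of [Q] do not share both coordinates, and [kern p]
    squares to 1. *)
Let avg_kern_kern p : p \in Q ->
  avg (fun c => (\sum_(q in Q) kern q c) * kern p c) = 1.
Proof.
move=> pQ.
have -> : avg (fun c => (\sum_(q in Q) kern q c) * kern p c)
    = avg (fun c => \sum_(q in Q) kern q c * kern p c).
  by apply: eq_avg => c; rewrite mulr_suml.
rewrite avg_sum (bigD1 p)//= big1 ?addr0.
  rewrite -[RHS](@avg_cst R 'I_n 'I_(4 * m) A_gt0 1); apply: eq_avg => c.
  by rewrite /kern mulrACA -!expr2 half_sqr outer_sqr mulr1.
move=> q /andP[qQ qp].
apply: (avg_kernM (neqQ pQ) (kern_dep (p := q))).
apply: contra qp => pS; apply/eqP; apply: in_QS pS => //.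
by have [qb _ _] := QP qQ; exact: band_near.
Qed.

Let card_Q : ((n - 2 * d) * d <= #|Q|)%N.
Proof.
have bound (u : 'I_(n - 2 * d) * 'I_d) : (d + u.1 + u.2.+1 < n)%N.
  by case: u => -[a ha] [b hb] /=; lia.
have bound1 (u : 'I_(n - 2 * d) * 'I_d) : (d + u.1 < n)%N.
  by case: u => -[a ha] [b hb] /=; lia.
pose h (u : 'I_(n - 2 * d) * 'I_d) := (Ordinal (bound1 u), Ordinal (bound u)).
have <- : #|h @: [set: 'I_(n - 2 * d) * 'I_d]%SET| = ((n - 2 * d) * d)%N.
  rewrite card_imset ?cardsT ?card_prod ?card_ord// => -[a b] [a' b'] [] E1 E2.
  by congr (_, _); apply: ord_inj; lia.
apply: subset_leq_card; apply/fintype.subsetP => p /imsetP[-[a b] _ ->].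
by rewrite !inE /=; have := ltn_ord b; lia.
Qed.

Lemma grid_variance :
  ((n - 2 * d) * d)%:R / 64 <= avg (fun c => (X c - avg X) ^+ 2).
Proof.
set mu := avg X; pose L c := \sum_(p in Q) kern p c.
have XL : avg (fun c => (X c - mu) * L c) = - (#|Q|%:R / 8).
  have -> : avg (fun c => (X c - mu) * L c)
      = \sum_(p in Q) avg (fun c => X c * kern p c - mu * kern p c).
    by rewrite -avg_sum; apply: eq_avg => c; rewrite mulr_sumr;
       apply: eq_bigr => p _; rewrite mulrBl.
  rewrite (eq_bigr (fun=> - 8^-1)); last first.
    by move=> p pQ; rewrite avgB avgZ avg_kern// mulr0 subr0 avg_X_kern.
  by rewrite sumr_const -[_ *+ _]mulr_natr; ring.
have LL : avg (fun c => L c * L c) = #|Q|%:R.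
  have -> : avg (fun c => L c * L c) = \sum_(p in Q) avg (fun c => L c * kern p c).
    by rewrite -avg_sum; apply: eq_avg => c; rewrite mulr_sumr.
  rewrite (eq_bigr (fun=> 1)); last by move=> p pQ; exact: avg_kern_kern.
  by rewrite sumr_const.
(* The Cauchy-Schwarz argument with the optimal coefficient: the covariance with [L] is [- #|Q| / 8]
   and the second moment of [L] is [#|Q|]. *)
have : 0 <= avg (fun c => (X c - mu + 8^-1 * L c) ^+ 2).
  rewrite -[leLHS](@avg_cst R 'I_n 'I_(4 * m) A_gt0 0).
  by apply: le_avg => c; exact: sqr_ge0.
have -> : avg (fun c => (X c - mu + 8^-1 * L c) ^+ 2) = avg (fun c =>
    (X c - mu) ^+ 2 + (4^-1 * ((X c - mu) * L c) + 64^-1 * (L c * L c))).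
  by apply: eq_avg => c; field.
rewrite !avgD !avgZ XL LL.
have : ((n - 2 * d) * d)%:R <= #|Q|%:R :> R by rewrite ler_nat card_Q.
lra.
Qed.

End grid_model.

(** * The law of the inversion count *)

Section discretisation.
Context {disp : measure_display} {T : measurableType disp} {R : realType}.
Variables (P : probability T R) (W : weyl) (n d : nat).
Variable Z : 'I_n -> {RV P >-> R}.
Hypothesis hZ : iid_with_law Z (unif_law W).

Lemma XinvE t : Xinv W d Z t = (inv_count W d (fun i j => Z j t < Z i t)
  (fun i j => Z j t < - Z i t) (fun i => Z i t < 0))%:R.
Proof.
rewrite /Xinv /inv_count /anti_pairs /sign_indices; case: W.
- by rewrite !big_set0 !addn0 natr_sum.
- rewrite !natrD !natr_sum; congr (_ + _).
  by apply: eq_bigl => i; rewrite inE.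
- by rewrite big_set0 addn0 natrD !natr_sum.
Qed.

Definition inv_law (v : nat) : R := fine (P (Xinv W d Z @^-1` [set v%:R])).

Let sum_disjoint_le (I : finType) (F : I -> set T) (D : pred I) (A : set T) :
  (forall i, measurable (F i)) -> (forall i j, i != j -> F i `&` F j = set0) ->
  measurable A -> (forall i, D i -> F i `<=` A) ->
  (\sum_(i | D i) P (F i) <= P A)%E.
Proof.
move=> mF disj mA FA; rewrite -big_filter.
have sD : {in [seq i <- index_enum I | D i], forall i, F i `<=` A}.
  by move=> i; rewrite mem_filter => /andP[/FA].
have us : uniq [seq i <- index_enum I | D i].
  by rewrite filter_uniq// index_enum_uniq.
clear FA; elim: [seq i <- index_enum I | D i] A mA sD us => [|i s IH] A mA sA /=.
  by rewrite big_nil.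
move=> /andP[ins us]; rewrite big_cons.
have iA : F i `<=` A by apply: sA; rewrite mem_head.
have -> : P A = (P (F i) + P (A `\` F i))%E.
  rewrite -measureU//; first by rewrite setDUK.
    exact: measurableD.
  by rewrite setDIK.
apply: leeD => //; apply: IH => //; first exact: measurableD.
move=> j js t Fjt; split; first by apply: (sA j) => //; rewrite inE js orbT.
move=> Fit; have : (F i `&` F j) t by [].
by rewrite disj//; apply: contraNneq ins => ->.
Qed.

Section fixed_mesh.
Variable m : nat.
Hypothesis m_gt0 : (0 < m)%N.

Let lo : R := unif_lower W.
Let h : R := (1 - lo) / (4 * m)%:R.

Let M_gt0 : 0 < (4 * m)%:R :> R. Proof. by rewrite ltr0n muln_gt0. Qed.

Let lo1 : lo < 1. Proof. exact: unif_lower_lt1. Qed.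

Let h_gt0 : 0 < h. Proof. by rewrite divr_gt0// subr_gt0. Qed.

Let cell (a : nat) : set R := `[lo + a%:R * h, lo + a.+1%:R * h[%classic.

Let measurable_cell a : measurable (cell a). Proof. exact: measurable_itv. Qed.

Let unif_cell (a : 'I_(4 * m)) : unif_law W (cell a) = ((4 * m)%:R^-1)%:E.
Proof.
have ah0 : 0 <= a%:R * h by rewrite mulr_ge0// ltW.
have ah1 : a.+1%:R * h <= 1 - lo.
  rewrite /h mulrCA ler_piMr ?subr_ge0 ?(ltW lo1)//.
  by rewrite ler_pdivrMr// mul1r ler_nat.
rewrite /unif_law /uniform_prob.
rewrite (eq_integral (fun=> ((1 - lo)^-1)%:E)); last first.
  move=> x; rewrite inE /cell /= in_itv /= => /andP[x1 x2].
  rewrite /uniform_pdf -/lo ifT//; apply/andP; split; lra.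
rewrite integral_cst; last exact: measurable_itv.
rewrite /= /cell lebesgue_measure_itv /= lte_fin.
rewrite ltrD2l ltr_pM2r// ltr_nat ltnSn -EFinD -EFinM; congr EFin.
rewrite -natr1 /h; field.
by rewrite pnatr_eq0 -lt0n m_gt0 subr_eq0 gt_eqF.
Qed.

Let box (c : {ffun 'I_n -> 'I_(4 * m)}) : set T :=
  \bigcap_(i in [set` [set: 'I_n]%SET]) Z i @^-1` cell (c i).

Let measurable_box c : measurable (box c).
Proof.
apply: fin_bigcap_measurable; first exact: finite_finset.
by move=> i _; rewrite -[X in measurable X]setTI; exact: measurable_funPT.
Qed.

Let box_mem c t : box c t <-> forall i, cell (c i) (Z i t).
Proof.
split=> [bt i|bt i _]; last exact: bt.
by apply: bt; rewrite /= finset.in_setT.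
Qed.

Let box_disjoint c c' : c != c' -> box c `&` box c' = set0.
Proof.
move=> cc'; apply/seteqP; split=> // t [/box_mem bc /box_mem bc'].
case/eqP: cc'; apply/ffunP => i; apply: ord_inj.
have := bc i; have := bc' i; rewrite /cell /= !in_itv /=.
move=> /andP[l1 u1] /andP[l2 u2].
have : (c i)%:R * h < (c' i).+1%:R * h by lra.
have : (c' i)%:R * h < (c i).+1%:R * h by lra.
rewrite !ltr_pM2r// !ltr_nat !ltnS => le1 le2.
by apply/eqP; rewrite eqn_leq le1 le2.
Qed.

Let P_box c : P (box c) = (#|{ffun 'I_n -> 'I_(4 * m)}|%:R^-1)%:E.
Proof.
have [ind law] := hZ.
rewrite /box ind//.
rewrite (eq_bigr (fun=> ((4 * m)%:R^-1)%:E)); last first.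
  by move=> i _; rewrite -(unif_cell (c i)) -(law i _ (measurable_cell (c i))).
rewrite prodEFin; congr EFin.
rewrite prodr_const card_ffun !card_ord natrX exprVn.
by congr (_ ^- _); rewrite cardsT card_ord.
Qed.

(** No two coordinates share a cell or lie in opposite cells, so that every comparison in the
    inversion count can be read off the cell indices. *)
Let good (c : {ffun 'I_n -> 'I_(4 * m)}) : bool :=
  [forall i, forall j, (i != j) ==> (c i != c j) && (c i + c j != (4 * m).-1)%N].

Let Xinv_box c t : good c -> box c t -> Xinv W d Z t = (grid_count W d c)%:R.
Proof.
move=> /forallP gc /box_mem bt; rewrite XinvE /grid_count /inv_count.
have cellP i : lo + (c i)%:R * h <= Z i t < lo + (c i).+1%:R * h.
  by have := bt i; rewrite /cell /= in_itv.
have neq i j : i != j -> (c i != c j :> nat) && (c i + c j != (4 * m).-1)%N.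
  by move=> ij; have /forallP/(_ j)/implyP/(_ ij) := gc i; rewrite -val_eqE.
have le_h (a b : nat) : (a <= b)%N -> a%:R * h <= b%:R * h.
  by move=> ab; rewrite ler_pM2r// ler_nat.
have hM : (4 * m)%:R * h = 1 - lo by rewrite /h mulrC divfK// gt_eqF.
congr (_ + _ + _)%:R.
- apply: eq_bigr => p; rewrite inE => /andP[p12 _]; congr nat_of_bool.
  have /andP[cp _] : (c p.1 != c p.2 :> nat) && (c p.1 + c p.2 != (4 * m).-1)%N.
    by apply: neq; rewrite -val_eqE neq_ltn p12.
  have /andP[l1 u1] := cellP p.1; have /andP[l2 u2] := cellP p.2.
  case: (ltngtP (c p.2) (c p.1)) => [/le_h lt|/le_h lt|E].
  + by lra.
  + by apply/negbTE; rewrite -leNgt; lra.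
  + by rewrite E eqxx in cp.
- apply: eq_bigr => p pa; congr nat_of_bool.
  have p12 : (p.1 < p.2)%N.
    by move: pa; rewrite /anti_pairs; case: W; rewrite inE => // /andP[].
  have lo' : lo = -1.
    by move: pa; rewrite /anti_pairs /lo; case: W; rewrite ?inE.
  have /andP[_ cp] : (c p.1 != c p.2 :> nat) && (c p.1 + c p.2 != (4 * m).-1)%N.
    by apply: neq; rewrite -val_eqE neq_ltn p12.
  have /andP[l1 u1] := cellP p.1; have /andP[l2 u2] := cellP p.2.
  case: (ltngtP (c p.1 + c p.2) (4 * m).-1) => [lt|lt|E].
  + have : ((c p.1).+1 + (c p.2).+1 <= 4 * m)%N by lia.
    by move=> /le_h; rewrite natrD mulrDl hM; lra.
  + have : (4 * m <= c p.1 + c p.2)%N by lia.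
    move=> /le_h; rewrite natrD mulrDl hM => le.
    by apply/negbTE; rewrite -leNgt; lra.
  + by rewrite E eqxx in cp.
apply: eq_bigr => i si; congr nat_of_bool.
have lo' : lo = -1.
  by move: si; rewrite /sign_indices /lo; case: W; rewrite ?inE.
have /andP[l1 u1] := cellP i.
have hM2 : (2 * m)%:R * h = 1.
  by move: hM; rewrite lo' !natrM; lra.
case: (ltnP (c i) (2 * m)) => [/le_h lt|/le_h lt].
  by lra.
by apply/negbTE; rewrite -leNgt; lra.
Qed.

(** A union bound: for each pair of distinct indices, either kind of tie fixes the second cell given
    the first one. *)
Let avg_bad : avg (fun c => (~~ good c)%:R : R) <= (2 * n ^ 2)%:R / (4 * m)%:R.
Proof.
have A_gt0 : (0 < #|'I_(4 * m)|)%N by rewrite card_ord muln_gt0.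
have eq1 i j : i != j ->
    avg (fun c : {ffun 'I_n -> 'I_(4 * m)} => (c i == c j)%:R : R) = (4 * m)%:R^-1.
  move=> ij; rewrite (avg_coord2 A_gt0 (fun a b : 'I_(4 * m) => (a == b)%:R) ij).
  rewrite (eq_bigr (fun=> 1)); last first.
    move=> a _; rewrite (bigD1 a)//= eqxx big1 ?addr0// => b.
    by rewrite eq_sym => /negbTE ->.
  rewrite sumr_const !card_ord expr2 -mulrA mulVf ?mulr1// gt_eqF//.
have eq2 i j : i != j ->
    avg (fun c : {ffun 'I_n -> 'I_(4 * m)} => (c i + c j == (4 * m).-1)%N%:R : R)
    = (4 * m)%:R^-1.
  move=> ij; rewrite (avg_coord2 A_gt0 (fun a b : 'I_(4 * m) =>
    (a + b == (4 * m).-1)%N%:R) ij).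
  rewrite (eq_bigr (fun=> 1)); last first.
    move=> a _; rewrite (bigD1 (rev_ord a))//=.
    rewrite (_ : (a + _)%N == _) ?big1 ?addr0//.
      move=> b ba; case: eqP => // E; case/eqP: ba; apply: ord_inj => /=.
      by have := ltn_ord a; lia.
    by apply/eqP => /=; have := ltn_ord a; lia.
  rewrite sumr_const !card_ord expr2 -mulrA mulVf ?mulr1// gt_eqF//.
apply: (@le_trans _ _ (avg (fun c : {ffun 'I_n -> 'I_(4 * m)} =>
  \sum_(p : 'I_n * 'I_n | p.1 != p.2)
    ((c p.1 == c p.2)%:R + (c p.1 + c p.2 == (4 * m).-1)%N%:R : R)))).
  apply: le_avg => c; case: (boolP (good c)) => [_|] /=.
    by apply: sumr_ge0 => p _; rewrite addr_ge0.
  move=> /forallPn[i /forallPn[j]]; rewrite negb_imply negb_and !negbK.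
  move=> /andP[ij bad]; rewrite (bigD1 (i, j))//=.
  apply: (@le_trans _ _ ((c i == c j)%:R + (c i + c j == (4 * m).-1)%N%:R)).
    by rewrite -natrD ler_nat; case/orP: bad => ->; rewrite ?addn1.
  by rewrite lerDl; apply: sumr_ge0 => p _; rewrite addr_ge0.
rewrite avg_sum (eq_bigr (fun=> 2 / (4 * m)%:R)); last first.
  by move=> p p12; rewrite avgD eq1// eq2//; lra.
rewrite sumr_const -[_ *+ _]mulr_natl mulrA ler_pM2r ?invr_gt0//.
rewrite mulrC -natrM ler_nat leq_mul2l /= (leq_trans (max_card _))//.
by rewrite card_prod card_ord -mulnn.
Qed.

Lemma inv_law_grid v :
  `|inv_law v - avg (fun c : {ffun 'I_n -> 'I_(4 * m)} => (grid_count W d c == v)%:R)|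
  <= (2 * n ^ 2)%:R / (4 * m)%:R.
Proof.
have A_gt0 : (0 < #|'I_(4 * m)|)%N by rewrite card_ord muln_gt0.
(* Disjoint good boxes inside [A] bound [P A] only from below. Applied to the event and to its
   complement, this gives both sides of the estimate. *)
have lower (b : bool) (A : set T) : measurable A ->
    (forall c : {ffun 'I_n -> 'I_(4 * m)}, good c -> (grid_count W d c == v) = b -> box c `<=` A) ->
    avg (fun c : {ffun 'I_n -> 'I_(4 * m)} => ((grid_count W d c == v) == b)%:R) - (2 * n ^ 2)%:R / (4 * m)%:R
    <= fine (P A).
  move=> mA boxA.
  have le1 := @sum_disjoint_le _ box (fun c : {ffun 'I_n -> 'I_(4 * m)} => good c && ((grid_count W d c == v) == b))
    A measurable_box box_disjoint mA.
  have {le1} : (\sum_(c | good c && ((grid_count W d c == v) == b)) P (box c) <= P A)%E.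
    by apply: le1 => c /andP[gc /eqP cb]; exact: boxA.
  rewrite (eq_bigr (fun=> (#|{ffun 'I_n -> 'I_(4 * m)}|%:R^-1)%:E)); last first.
    by move=> c _; exact: P_box.
  rewrite sumEFin -[X in (_ <= X)%E]fineK ?fin_num_measure// lee_fin.
  apply: le_trans; rewrite lerBlDr.
  apply: (@le_trans _ _ (avg (fun c : {ffun 'I_n -> 'I_(4 * m)} =>
    (good c && ((grid_count W d c == v) == b))%:R + (~~ good c)%:R))).
    apply: le_avg => c; rewrite -natrD ler_nat.
    by case: (good c); case: (_ == b).
  rewrite avgD lerD//.
  by rewrite /avg mulr_sumr [leRHS]big_mkcond le_eqVlt; apply/orP; left;
    apply/eqP; apply: eq_bigr => c _; case: (_ && _); rewrite ?mulr1 ?mulr0.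
have mX : measurable (Xinv W d Z @^-1` [set v%:R]).
  by rewrite -[X in measurable X]setTI; exact: measurable_funPT.
have l1 := lower true _ mX; have l2 := lower false _ (measurableC mX).
have {}l1 := l1 _; have {}l2 := l2 _.
have h1 : avg (fun c : {ffun 'I_n -> 'I_(4 * m)} => ((grid_count W d c == v) == true)%:R)
    - (2 * n ^ 2)%:R / (4 * m)%:R <= inv_law v.
  apply: l1 => c gc /eqP cv t bt /=; rewrite (Xinv_box gc bt) cv.
  by [].
have h2 : avg (fun c : {ffun 'I_n -> 'I_(4 * m)} => ((grid_count W d c == v) == false)%:R)
    - (2 * n ^ 2)%:R / (4 * m)%:R <= 1 - inv_law v.
  have -> : 1 - inv_law v = fine (P (~` (Xinv W d Z @^-1` [set v%:R]))).
    by rewrite probability_setC// fineB ?fin_num_measure.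
  apply: l2 => c gc /negP cv t bt /=.
  rewrite (Xinv_box gc bt) => /eqP; rewrite eqr_nat => E.
  exact: cv.
have h3 : avg (fun c : {ffun 'I_n -> 'I_(4 * m)} => ((grid_count W d c == v) == false)%:R) =
    1 - avg (fun c : {ffun 'I_n -> 'I_(4 * m)} => (grid_count W d c == v)%:R) :> R.
  rewrite -[X in X - _](@avg_cst R 'I_n 'I_(4 * m) A_gt0 1) -avgB.
  by apply: eq_avg => c; case: (_ == v); rewrite ?subrr ?subr0.
have h4 : avg (fun c : {ffun 'I_n -> 'I_(4 * m)} => ((grid_count W d c == v) == true)%:R) =
    avg (fun c : {ffun 'I_n -> 'I_(4 * m)} => (grid_count W d c == v)%:R) :> R.
  by apply: eq_avg => c; rewrite eqb_id.
by rewrite ler_norml; lra.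
Qed.

End fixed_mesh.

End discretisation.

(** * Passage from the grid to the law of the inversion count *)

Section law_of_inversions.
Context {disp : measure_display} {T : measurableType disp} {R : realType}.
Variables (P : probability T R) (W : weyl) (n d : nat).
Variable Z : 'I_n -> {RV P >-> R}.
Hypothesis hZ : iid_with_law Z (unif_law W).

Let N := (2 * n ^ 2).+1.
Let p (v : 'I_N) : R := inv_law W d Z v.

(** The count takes the finitely many values [0, ..., 2 * n ^ 2], so the expectation of an arbitrary
    function of it is a finite sum, free of measurability and integrability conditions. *)
Definition law_mean (h : R -> R) : R := \sum_(v < N) p v * h v%:R.

Let X := Xinv W d Z.

Let XN t : exists v : 'I_N, X t = v%:R.
Proof.
rewrite /X XinvE; set v := inv_count _ _ _ _ _.
have vN : (v < N)%N by rewrite ltnS inv_count_le.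
by exists (Ordinal vN).
Qed.

Let measurable_fiber (v : nat) : measurable (X @^-1` [set v%:R]).
Proof. by rewrite -[X in measurable X]setTI; exact: measurable_funPT. Qed.

Lemma integral_Xinv (h : R -> R) :
  (\int[P]_t (h (X t))%:E = (law_mean h)%:E)%E.
Proof.
rewrite (eq_integral (fun t => \sum_(v < N)
    ((h v%:R)%:E * (\1_(X @^-1` [set v%:R]) t)%:E)%E)%E); last first.
  move=> t _; have [v Xv] := XN t.
  rewrite (bigD1 v)//= big1 ?adde0.
    by rewrite indicE mem_set//= mule1 Xv.
  move=> u uv; rewrite indicE memNset ?mule0//= Xv => /eqP.
  by rewrite eqr_nat => /eqP/ord_inj vu; rewrite vu eqxx in uv.
rewrite integral_sum//; last first.
  by move=> v; apply: integrableZl => //; exact: integrable_indic.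
rewrite /law_mean -sumEFin; apply: eq_bigr => v _.
rewrite integralZl//; last exact: integrable_indic.
rewrite integral_indic// setIT mulrC EFinM; congr (_ * _)%E.
by rewrite /p /inv_law fineK// fin_num_measure.
Qed.

Lemma law_mean1 : law_mean (fun=> 1) = 1.
Proof.
apply/EFin_inj; rewrite -(integral_Xinv (fun=> 1)) integral_cst// mul1e.
exact: probability_setT.
Qed.

Let mu : R := fine 'E_P[X].

Lemma expectation_Xinv : mu = law_mean id.
Proof. by rewrite /mu unlock (integral_Xinv id). Qed.

Lemma variance_Xinv :
  fine 'V_P[X] = law_mean (fun y => (y - mu) ^+ 2).
Proof.
rewrite /variance unlock -/mu unlock -[RHS]/(fine (_%:E)) -integral_Xinv.
by congr fine; apply: eq_integral => t _; rewrite expr2.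
Qed.

Lemma prob_Xinv_le (y : R) : P (X @^-1` `]-oo, y]%classic)
  = (1 - law_mean (fun v => (y < v)%R%:R))%:E.
Proof.
have mA : measurable (X @^-1` `]-oo, y]%classic).
  by rewrite -[X in measurable X]setTI; exact: measurable_funPT.
have -> : (1 - law_mean (fun v => (y < v)%R%:R))%:E
    = (law_mean (fun v => (v <= y)%R%:R))%:E.
  congr EFin; rewrite -[X in X - _]law_mean1 /law_mean -sumrB; apply: eq_bigr => v _.
  by rewrite -mulrBr; case: ltP => _ /=; rewrite ?subrr ?subr0.
rewrite -(integral_Xinv (fun v => (v <= y)%R%:R)).
transitivity (\int[P]_t (\1_(X @^-1` `]-oo, y]%classic) t)%:E)%E.
  by rewrite integral_indic// setIT.
apply: eq_integral => t _; rewrite indicE.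
rewrite (_ : (t \in _) = (X t <= y))//; apply/idP/idP;
  by rewrite inE /preimage /= in_itv.
Qed.

Lemma inv_law_ge0 (v : nat) : 0 <= inv_law W d Z v.
Proof. by rewrite fine_ge0. Qed.

Let gridR m (c : {ffun 'I_n -> 'I_(4 * m.+1)}) : R := (grid_count W d c)%:R.

(** No continuity of [h] is required: the grid laws and the limit live on the same finite set and
    converge atom by atom, at rate [1/m]. *)
Let avg_grid_cvg (h : R -> R) :
  avg (fun c => h (@gridR m c)) @[m --> \oo] --> law_mean h.
Proof.
have E m : avg (fun c => h (@gridR m c)) = \sum_(v < N)
    avg (fun c => (@grid_count W n d m.+1 c == v)%:R) * h v%:R.
  under [RHS]eq_bigr do rewrite mulrC -avgZ.
  rewrite -avg_sum; apply: eq_avg => c.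
  have vN : (grid_count W d c < N)%N by rewrite ltnS inv_count_le.
  rewrite (bigD1 (Ordinal vN))//= eqxx mulr1 big1 ?addr0// => v vc.
  rewrite (_ : grid_count W d c == v = false) ?mulr0//.
  by apply: contraNF vc => /eqP cv; apply/eqP/ord_inj.
under eq_fun do rewrite E.
rewrite /law_mean; apply: cvg_big => [|v _]; first exact: add_continuous.
apply: cvgMl.
pose C : R := (2 * n ^ 2)%:R / 4.
have C0 : C * harmonic m @[m --> \oo] --> (0 : R).
  by rewrite -(mulr0 C); apply: cvgMr; exact: cvg_harmonic.
apply: (@squeeze_cvgr _ _ _ _ (fun m => p v - C * harmonic m)
    (fun m => p v + C * harmonic m)).
- near=> m; rewrite -ler_distl distrC.
  have := inv_law_grid d hZ (ltn0Sn m) v.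
  by rewrite (natrM _ 4 m.+1) invfM mulrA.
- by rewrite -[X in _ --> X]subr0; apply: cvgB => //; exact: cvg_cst.
- by rewrite -[X in _ --> X]addr0; apply: cvgD => //; exact: cvg_cst.
Unshelve. all: end_near. Qed.

Let avg_grid_mean : avg (@gridR m) @[m --> \oo] --> mu.
Proof. by rewrite expectation_Xinv; exact: (@avg_grid_cvg id). Qed.

Let avg_grid_center (h : R -> R) :
  avg (fun c => (@gridR m c - avg (@gridR m)) * h (@gridR m c)) @[m --> \oo]
  --> law_mean (fun y => (y - mu) * h y).
Proof.
have -> : law_mean (fun y => (y - mu) * h y)
    = law_mean (fun y => y * h y) - mu * law_mean h.
  rewrite /law_mean mulr_sumr -sumrB; apply: eq_bigr => v _; ring.
have -> : (fun m => avg (fun c => (@gridR m c - avg (@gridR m)) * h (@gridR m c)))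
    = (fun m => avg (fun c => @gridR m c * h (@gridR m c))
                - avg (@gridR m) * avg (fun c => h (@gridR m c))).
  apply/funext => m; rewrite -avgZ -avgB; apply: eq_avg => c; ring.
by apply: cvgB; [exact: (@avg_grid_cvg (fun y => y * h y))|exact: cvgM].
Qed.

Let avg_grid_variance :
  avg (fun c => (@gridR m c - avg (@gridR m)) ^+ 2) @[m --> \oo]
  --> law_mean (fun y => (y - mu) ^+ 2).
Proof.
have -> : (fun m => avg (fun c => (@gridR m c - avg (@gridR m)) ^+ 2))
    = (fun m => avg (fun c => (@gridR m c - avg (@gridR m)) * @gridR m c)).
  apply/funext => m; have A_gt0 : (0 < #|'I_(4 * m.+1)|)%N by rewrite card_ord.
  set u := avg (@gridR m).
  have -> : avg (fun c => (@gridR m c - u) * @gridR m c)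
      = avg (fun c => (@gridR m c - u) ^+ 2 + u * (@gridR m c - u)).
    by apply: eq_avg => c; ring.
  by rewrite avgD avgZ avgB avg_cst// subrr mulr0 addr0.
have -> : law_mean (fun y => (y - mu) ^+ 2) = law_mean (fun y => (y - mu) * y).
  have -> : law_mean (fun y => (y - mu) ^+ 2)
      = law_mean (fun y => (y - mu) * y) - mu * (law_mean id - mu * law_mean (fun=> 1)).
    rewrite /law_mean !mulr_sumr -sumrB mulr_sumr -sumrB; apply: eq_bigr => v _; ring.
  by rewrite law_mean1 -expectation_Xinv mulr1 subrr mulr0 subr0.
exact: (@avg_grid_center id).
Qed.

Lemma law_stein (g g1 B : R -> R) :
  (forall x a, `|a| <= (16 * d.+1)%:R ->
    `|g (x + a) - g x - a * g1 x| <= a ^+ 2 * B x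
    /\ `|g1 (x + a) - g1 x| <= `|a| * B x) ->
  `|law_mean (fun y => (y - mu) * g y)
    - law_mean (fun y => (y - mu) ^+ 2) * law_mean g1|
  <= (640 * n * d.+1 ^ 3)%:R * law_mean B.
Proof.
move=> tay.
have lhs : `|avg (fun c => (@gridR m c - avg (@gridR m)) * g (@gridR m c))
    - avg (fun c => (@gridR m c - avg (@gridR m)) ^+ 2)
      * avg (fun c => g1 (@gridR m c))| @[m --> \oo]
  --> `|law_mean (fun y => (y - mu) * g y)
    - law_mean (fun y => (y - mu) ^+ 2) * law_mean g1|.
  by apply: cvg_norm; apply: cvgB => //; apply: cvgM.
have rhs : (640 * n * d.+1 ^ 3)%:R * avg (fun c => B (@gridR m c)) @[m --> \oo]
  --> (640 * n * d.+1 ^ 3)%:R * law_mean B by apply: cvgMr.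
apply: (ler_cvg_to lhs rhs); near=> m.
exact: (@grid_stein R W n d m.+1 (ltn0Sn m) g g1 B tay).
Unshelve. all: end_near. Qed.

Lemma law_variance_ge :
  ((n - 2 * d) * d)%:R / 64 <= law_mean (fun y => (y - mu) ^+ 2).
Proof.
apply: (ler_cvg_to (cvg_cst _) avg_grid_variance); near=> m.
exact: (@grid_variance R W n d m.+1 (ltn0Sn m)).
Unshelve. all: end_near. Qed.

End law_of_inversions.

(** * The standard normal distribution *)

Section standard_normal.
Context {R : realType}.
Implicit Types x y z : R.

Definition std_pdf z : R := (Num.sqrt (2 * pi))^-1 * expR (- z ^+ 2 / 2).
Definition std_cdf z : R := fine (normal_prob 0 1 `]-oo, z]%classic).

Let std_pdfE : normal_pdf 0 1 = std_pdf.
Proof.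
rewrite normal_pdfE ?oner_neq0//; apply/funext => z.
rewrite /std_pdf /normal_peak /normal_fun subr0 expr1n mul1r.
by rewrite -[pi *+ 2]mulr_natl.
Qed.

Lemma std_pdf_gt0 z : 0 < std_pdf z.
Proof. by rewrite mulr_gt0 ?expR_gt0// invr_gt0 sqrtr_gt0 mulr_gt0 ?pi_gt0. Qed.

Lemma std_pdf_le z : std_pdf z <= expR (- z ^+ 2 / 2).
Proof.
rewrite ler_piMl ?expR_ge0// invf_le1 ?sqrtr_gt0 ?mulr_gt0 ?pi_gt0//.
rewrite -[leLHS]sqrtr1 ler_wsqrtr//.
by have := pi_ge2 R; lra.
Qed.

Lemma is_derive_std_pdf z : is_derive z 1 std_pdf (- z * std_pdf z).
Proof.
apply: is_derive_eq.
by rewrite /std_pdf /GRing.scale /=; lra.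
Qed.

Lemma is_derive_std_cdf z : is_derive z 1 std_cdf (std_pdf z).
Proof.
have intf : lebesgue_measure.-integrable
    [set` Interval -oo%O (BRight (z + 1))] (EFin \o normal_pdf 0 (1 : R)).
  apply: (integrableS _ _ (subsetT _)) => //.
  exact: integrable_normal_pdf.
have z1 : z < z + 1 by rewrite ltrDl.
have cz : {for z, continuous (normal_pdf 0 (1 : R))}.
  by apply: continuous_normal_pdf; rewrite oner_neq0.
have [dF F'] := continuous_FTC1 z1 intf (ltNyr _) cz.
apply: DeriveDef => //; rewrite -std_pdfE -F' derive1E.
by [].
Qed.

Lemma std_cdf_ge0 z : 0 <= std_cdf z.
Proof. by rewrite fine_ge0. Qed.

Lemma std_cdf_le1 z : std_cdf z <= 1.
Proof.
rewrite -lee_fin fineK ?fin_num_measure//; exact: probability_le1.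
Qed.

Lemma std_cdf_homo : {homo std_cdf : x y / x <= y}.
Proof.
move=> x y xy; rewrite fine_le ?fin_num_measure// le_measure ?inE//.
by apply: subitvPr; rewrite bnd_simp.
Qed.

(** The identity as a random variable under the normal law: its distribution function is [std_cdf],
    which gives access to the limits of distribution functions. *)
Let idR : measurableTypeR R -> R := idfun.

Let measurable_idR : measurable_fun setT idR. Proof. exact: measurable_id. Qed.

HB.instance Definition _ := isMeasurableFun.Build _ _ _ _ idR measurable_idR.

Let std_law : probability (measurableTypeR R) R := normal_prob 0 1.

Lemma std_cdf_cvgy : std_cdf z @[z --> +oo] --> (1 : R).
Proof. by have /fine_cvgP[_] := @cvg_cdfy1 _ _ _ std_law idR. Qed.

Lemma std_cdf_cvgNy : std_cdf (- z) @[z --> +oo] --> (0 : R).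
Proof.
have := @cvg_cdfNy0 _ _ _ std_law idR; rewrite cvgNy_compNP.
by move=> /fine_cvgP[_].
Qed.

Lemma std_pdf_cvgy : std_pdf z @[z --> +oo] --> (0 : R).
Proof.
rewrite -(mulr0 (Num.sqrt (2 * pi))^-1); apply: cvgMr.
apply: (@squeeze_cvgr _ _ _ _ (fun=> 0) (fun z : R => expR (- z))).
- near=> z; rewrite expR_ge0 ler_expR.
  have z2 : 2 <= z by near: z; apply: nbhs_pinfty_ge; rewrite num_real.
  rewrite mulNr lerN2 ler_pdivlMr// expr2 ler_wpM2l//; lra.
- exact: cvg_cst.
- exact: cvgr_expR.
Unshelve. all: end_near. Qed.

Let ge0_of_decreasing (h dh : R -> R) y : 0 < y ->
  (forall z, 0 < z -> is_derive z 1 h (dh z)) ->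
  (forall z, 0 < z -> dh z <= 0) ->
  h z @[z --> +oo] --> (0 : R) -> 0 <= h y.
Proof.
move=> y0 hd dh0 hlim.
have h2 : forall z, y <= z -> h z <= h y.
  move=> z yz; apply: (@ler0_derive1_nincr _ h y z) => //.
  - move=> t; rewrite in_itv /= => /andP[yt _].
    by have [] := hd t (lt_trans y0 yt).
  - move=> t; rewrite in_itv /= => /andP[yt _].
    have /@derive_val dv := hd t (lt_trans y0 yt).
    by rewrite derive1E dv dh0// (lt_trans y0).
  - apply: derivable_within_continuous => t; rewrite in_itv /= => /andP[yt _].
    by have [] := hd t (lt_le_trans y0 yt).
apply: (ler_cvg_to hlim (cvg_cst (h y))).
by near=> z; apply: h2; near: z; apply: nbhs_pinfty_ge; rewrite num_real.
Unshelve. all: end_near. Qed.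

Let is_derive_tail z : is_derive z 1 (fun z => std_cdf (- z)) (- std_pdf z).
Proof.
have := is_derive_std_cdf (- z) => dF.
apply: is_derive_eq.
by rewrite /std_pdf sqrrN /GRing.scale /= mulrN1.
Qed.

(** Upper Mills bound: the difference of the two sides tends to 0 and has derivative
    [- std_pdf z / z ^+ 2]. *)
Lemma std_tail_le y : 0 < y -> std_cdf (- y) <= std_pdf y / y.
Proof.
move=> y0; rewrite -subr_ge0.
apply: (@ge0_of_decreasing (fun z => std_pdf z / z - std_cdf (- z))
  (fun z => - std_pdf z / z ^+ 2) y y0).
- move=> z z0; have zn : z != 0 by rewrite gt_eqF.
  have := is_derive_tail z => dt; have := is_derive_std_pdf z => dp.
  have dv := is_deriveV (f := id) zn (is_derive_id z 1).
  have dm := is_deriveM dp dv.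
  have db := is_deriveB dm dt.
  apply: is_derive_eq; rewrite /GRing.scale /=.
  field.
  by [].
- move=> z z0; rewrite mulNr oppr_le0 mulr_ge0 ?invr_ge0 ?sqr_ge0//.
  exact/ltW/std_pdf_gt0.
- rewrite -(subr0 0); apply: cvgB; last exact: std_cdf_cvgNy.
  apply: (@squeeze_cvgr _ _ _ _ (fun=> 0) std_pdf).
  + near=> z; have z1 : 1 <= z by near: z; apply: nbhs_pinfty_ge; rewrite num_real.
    have z0 : 0 < z by exact: lt_le_trans ltr01 z1.
    have p0 := std_pdf_gt0 z.
    apply/andP; split; first by rewrite divr_ge0 ?ltW.
    by rewrite ler_piMr ?invf_le1// ltW.
  + exact: cvg_cst.
  + exact: std_pdf_cvgy.
Unshelve. all: end_near. Qed.

(** Lower Mills bound, by the same monotonicity argument; the rational factor is chosen so that the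
    derivative of the difference collapses to a single negative term. *)
Lemma std_tail_ge y : 0 < y -> std_pdf y * y / (1 + y ^+ 2) <= std_cdf (- y).
Proof.
move=> y0; rewrite -subr_ge0.
apply: (@ge0_of_decreasing (fun z => std_cdf (- z) - std_pdf z * z / (1 + z ^+ 2))
  (fun z => - (2 * std_pdf z / (1 + z ^+ 2) ^+ 2)) y y0).
- move=> z z0; have zn : 1 + z ^+ 2 != 0.
    by rewrite gt_eqF// (lt_le_trans ltr01)// lerDl sqr_ge0.
  have := is_derive_tail z => dt; have := is_derive_std_pdf z => dp.
  apply: is_derive_eq; rewrite /GRing.scale /=.
  field.
  by [].
- move=> z z0; rewrite oppr_le0 mulr_ge0 ?invr_ge0 ?sqr_ge0// mulr_ge0//.
  exact/ltW/std_pdf_gt0.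
- rewrite -(subr0 0); apply: cvgB; first exact: std_cdf_cvgNy.
  apply: (@squeeze_cvgr _ _ _ _ (fun=> 0) std_pdf).
  + near=> z; have z1 : 1 <= z by near: z; apply: nbhs_pinfty_ge; rewrite num_real.
    have p0 := std_pdf_gt0 z.
    have q0 : 0 < 1 + z ^+ 2 by rewrite (lt_le_trans ltr01)// lerDl sqr_ge0.
    have z0 : 0 < z by exact: lt_le_trans ltr01 z1.
    apply/andP; split; first by rewrite divr_ge0 ?mulr_ge0// ltW.
    by rewrite ler_pdivrMr// ler_wpM2l//; [rewrite ltW|nra].
  + exact: cvg_cst.
  + exact: std_pdf_cvgy.
Unshelve. all: end_near. Qed.

End standard_normal.

(** * Moderate deviations from a Stein identity *)

Section second_order.
Context {R : realType}.

Lemma mean_value (f df : R -> R) (x a : R) : (forall y : R, is_derive y 1 f (df y)) ->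
  exists2 c, `|c - x| <= `|a| & f (x + a) - f x = df c * a.
Proof.
move=> fd; have cf y z : {within `[y, z], continuous f}.
  by apply: derivable_within_continuous => t _; have [] := fd t.
have [a0|a0] := leP 0 a.
  have [|c cI ->] := @MVT_segment _ f df x (x + a) _ (fun t _ => fd t) (cf _ _).
    by rewrite lerDl.
  exists c; last by congr (_ * _); ring.
  move: cI; rewrite in_itv /= => /andP[xc cx].
  by rewrite !ger0_norm ?subr_ge0//; lra.
have [|c cI E] := @MVT_segment _ f df (x + a) x _ (fun t _ => fd t) (cf _ _).
  by rewrite gerDl ltW.
exists c; last by rewrite -opprB E; ring.
move: cI; rewrite in_itv /= => /andP[xc cx].
by rewrite distrC ger0_norm ?subr_ge0// ltr0_norm//; lra.
Qed.

(** The mean value theorem is applied twice, which gives [a ^+ 2 * b] in place of the sharper half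
    of it. *)
Lemma taylor_bound (g g1 g2 : R -> R) (K b x a : R) :
  (forall y : R, is_derive y 1 g (g1 y)) -> (forall y : R, is_derive y 1 g1 (g2 y)) ->
  (forall y, `|y - x| <= K -> `|g2 y| <= b) -> `|a| <= K ->
  `|g (x + a) - g x - a * g1 x| <= a ^+ 2 * b
  /\ `|g1 (x + a) - g1 x| <= `|a| * b.
Proof.
move=> dg dg1 g2b aK.
have g1b u : `|u| <= `|a| -> `|g1 (x + u) - g1 x| <= `|u| * b.
  move=> ua; have [c cx ->] := mean_value x u dg1.
  rewrite normrM mulrC ler_wpM2l// g2b//.
  exact: le_trans cx (le_trans ua aK).
split; last exact: g1b.
have [c cx E] := mean_value x a dg.
rewrite E (mulrC (g1 c)) -mulrBr normrM -real_normK ?num_real// expr2 -mulrA.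
rewrite ler_wpM2l//.
have := g1b (c - x) cx; rewrite subrKC => /le_trans; apply.
rewrite ler_wpM2r//.
by apply: le_trans (g2b x _); rewrite // subrr normr0 (le_trans _ aK).
Qed.

End second_order.

Section moderate_deviations.
Context {R : realType} {J : finType}.
Implicit Types t s r y u v z : R.
Variables (p w : J -> R) (eps K : R).
Hypothesis p_ge0 : forall j, 0 <= p j.
Hypothesis p_sum : \sum_j p j = 1.
Hypotheses (eps_ge0 : 0 <= eps) (K_ge0 : 0 <= K).

Let E (h : R -> R) := \sum_j p j * h (w j).

Hypothesis stein : forall g g1 B : R -> R,
  (forall x a, `|a| <= K ->
     `|g (x + a) - g x - a * g1 x| <= a ^+ 2 * B x
     /\ `|g1 (x + a) - g1 x| <= `|a| * B x) ->
  `|E (fun x => x * g x) - E g1| <= eps * E B.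

Let E_le h h' : (forall x, h x <= h' x) -> E h <= E h'.
Proof. by move=> hh; apply: ler_sum => j _; rewrite ler_wpM2l. Qed.

Let EZ c h : E (fun x => c * h x) = c * E h.
Proof. by rewrite /E mulr_sumr; apply: eq_bigr => j _; rewrite mulrCA. Qed.

Let EB h h' : E (fun x => h x - h' x) = E h - E h'.
Proof. by rewrite /E -sumrB; apply: eq_bigr => j _; rewrite mulrBr. Qed.

Let E_cst c : E (fun=> c) = c.
Proof. by rewrite /E -mulr_suml p_sum mul1r. Qed.

Let is_derive_E (h dh : R -> R -> R) (r : R) :
  (forall x : R, is_derive r 1 (h ^~ x) (dh r x)) ->
  is_derive r 1 (fun r : R => E (h r)) (E (dh r)).
Proof.
move=> hd.
have -> : (fun r => E (h r)) = \sum_(j < #|J|) (fun r => p (enum_val j) * h r (w (enum_val j))).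
  apply/funext => t; rewrite fct_sumE /E (big_enum_val (fun j => p j * h t (w j)))//=.
have -> : E (dh r) = \sum_(j < #|J|) p (enum_val j) * dh r (w (enum_val j)).
  by rewrite /E (big_enum_val (fun j => p j * dh r (w j))).
by apply: is_derive_sum => j; exact: is_deriveZ (hd _).
Qed.

Definition mgf t : R := E (fun x => expR (t * x)).

Let mgf_ge0 t : 0 <= mgf t.
Proof. by apply: sumr_ge0 => j _; rewrite mulr_ge0 ?expR_ge0. Qed.

(** The Stein inequality for an exponential [g]: within distance [K] its second derivative grows by
    a factor of at most [exp (t K) <= e]. *)
Let mgf_stein t : 0 <= t -> t * K <= 1 ->
  E (fun x => x * expR (t * x)) <= (t + expR 1 * eps * t ^+ 2) * mgf t.
Proof.
move=> t0 tK.
have : `|E (fun x => x * expR (t * x)) - E (fun x => t * expR (t * x))|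
    <= eps * E (fun x => expR 1 * t ^+ 2 * expR (t * x)).
  apply: (stein (g := fun x => expR (t * x))) => x a aK.
  apply: (@taylor_bound _ (fun y => expR (t * y)) (fun y => t * expR (t * y))
    (fun y => t * (t * expR (t * y))) K); [move=> y|move=> y|move=> y yx|exact: aK].
  - by apply: is_derive_eq; rewrite /GRing.scale /=; ring.
  - by apply: is_derive_eq; rewrite /GRing.scale /=; ring.
  - rewrite ger0_norm ?mulr_ge0 ?expR_ge0//.
    rewrite (mulrC (expR 1)) -!mulrA ler_wpM2l// ler_wpM2l//.
    rewrite -expRD ler_expR.
    have : t * (y - x) <= t * K.
      by rewrite ler_wpM2l// (le_trans _ yx)// ler_norm.
    by lra.
rewrite !EZ -/(mgf t) => /(le_trans (ler_norm _)); rewrite mulrDl; lra.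
Qed.

(** A Gronwall argument: [mgf_stein] bounds the derivative of [mgf], so [mgf] divided by the claimed
    bound is nonincreasing and equals 1 at 0. *)
Lemma mgf_le t : 0 <= t -> t * K <= 1 ->
  mgf t <= expR (t ^+ 2 / 2 + expR 1 * eps * t ^+ 3).
Proof.
move=> t0 tK; set e1 := expR 1.
have e10 : 0 <= e1 * eps by rewrite mulr_ge0 ?expR_ge0.
pose h s := mgf s * expR (- (s ^+ 2 / 2 + e1 * eps * s ^+ 3)).
pose dh s := (E (fun x => x * expR (s * x)) -
  (s + 3 * (e1 * eps) * s ^+ 2) * mgf s) * expR (- (s ^+ 2 / 2 + e1 * eps * s ^+ 3)).
have hd (s : R) : is_derive s 1 h (dh s).
  have dm : is_derive s 1 mgf (E (fun x => x * expR (s * x))).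
    apply: (@is_derive_E (fun r x => expR (r * x)) (fun r x => x * expR (r * x))) => x.
    apply: is_derive_eq; rewrite /GRing.scale /=; ring.
  apply: is_derive_eq; rewrite /dh /GRing.scale /=.
  by set X := expR _; set Y := E _; set Z := mgf s; field.
suff : h t <= h 0.
  have m0 : mgf 0 = 1.
    by rewrite /mgf -[RHS](E_cst 1); apply: eq_bigr => j _; rewrite mul0r expR0.
  rewrite /h m0 !expr0n /= mul0r mulr0 addr0 oppr0 expR0 mulr1 expRN.
  by rewrite ler_pdivrMr ?expR_gt0// mul1r.
apply: (@ler0_derive1_nincr _ h 0 t) => //.
- move=> v; rewrite in_itv /= => /andP[v0 vt].
  have [_ dv] := hd v; rewrite derive1E dv /dh.
  rewrite mulr_le0_ge0 ?expR_ge0// subr_le0.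
  apply: le_trans (mgf_stein (ltW v0) _) _.
    by apply: le_trans tK; rewrite ler_wpM2r// ltW.
  rewrite ler_wpM2r// lerD2l -/e1 ler_wpM2r ?sqr_ge0//; lra.
- apply: derivable_within_continuous => v _.
  by have [] := hd v.
Qed.

Variables (x q : R).
Hypotheses (x_gt0 : 0 < x) (q_gt0 : 0 < q) (xq_le1 : x * q <= 1).
Hypotheses (xK : x * K <= 1) (xeps : expR 1 * eps * x ^+ 3 <= 1).

(* The Gaussian interpolation [E Phi((r W + sqrt(1 - r^2) N - x) / q)], with
   the independent standard normal [N] already integrated out. *)
Let s r : R := Num.sqrt (1 + q ^+ 2 - r ^+ 2).
Let zz r y : R := (r * y - x) / s r.
Let F r : R := E (fun y => std_cdf (zz r y)).
Let g r y : R := std_pdf (zz r y).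
Let g1 r y : R := - zz r y * std_pdf (zz r y) * (r / s r).
Let g2 r y : R := (zz r y ^+ 2 - 1) * std_pdf (zz r y) * (r / s r) ^+ 2.
(** A majorant of [g2] near [y], obtained by completing the square: with [z = zz r y] and
    [u = z + x s], [- z^2/2 = - u^2/2 - x^2 + x r y + x^2 s^2/2]. The factor [exp (- u^2/2)] absorbs
    the polynomial in [u] and leaves an exponential in [y], whose mean is a value of [mgf]. The
    summand 1 in the exponent pays for moving [y] by at most [K]. *)
Let B r y : R := (r / s r) ^+ 2 * (5 + 2 * x ^+ 2 * s r ^+ 2)
  * expR (1 - x ^+ 2 + x ^+ 2 * s r ^+ 2 / 2) * expR (x * r * y).

Let xq_ge0 : 0 <= x * q. Proof. by rewrite mulr_ge0 ?ltW. Qed.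

Let s_gt0 r : 0 <= r <= 1 -> 0 < s r.
Proof.
move=> /andP[r0 r1]; rewrite sqrtr_gt0.
have : 0 < q ^+ 2 by rewrite exprn_gt0.
nra.
Qed.

Let sqr_s r : 0 <= r <= 1 -> s r ^+ 2 = 1 + q ^+ 2 - r ^+ 2.
Proof.
move=> r01; rewrite sqr_sqrtr//; have := s_gt0 r01.
by rewrite sqrtr_gt0 => /ltW.
Qed.

Let q_le_s r : 0 <= r <= 1 -> q <= s r.
Proof.
move=> r01; have sr := s_gt0 r01.
rewrite -(@ler_pXn2r _ 2) ?nnegrE ?(ltW q_gt0) ?(ltW sr)// sqr_s//.
case/andP: r01 => r0 r1; have : r ^+ 2 <= 1 by exact: exprn_ile1.
lra.
Qed.

Let is_derive_zz r y : is_derive y 1 (zz r) (r / s r).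
Proof. by apply: is_derive_eq; rewrite /GRing.scale /=; ring. Qed.

Let is_derive_g r y : is_derive y 1 (g r) (g1 r y).
Proof.
have d := is_derive1_comp (is_derive_std_pdf (zz r y)) (is_derive_zz r y).
exact: d.
Qed.

Let is_derive_g1 r y : is_derive y 1 (g1 r) (g2 r y).
Proof.
have d := is_derive1_comp (is_derive_std_pdf (zz r y)) (is_derive_zz r y).
have dz := is_derive_zz r y.
apply: is_derive_eq; rewrite /g2 /GRing.scale /=; ring.
Qed.

Let g2_le r y v : 0 <= r <= 1 -> `|y - v| <= K -> `|g2 r y| <= B r v.
Proof.
move=> r01 yv; have sr := s_gt0 r01; have [r0 r1] := andP r01.
set z := zz r y.
have zs : z * s r = r * y - x by rewrite /z /zz divfK ?gt_eqF.
rewrite /g2 normrM (ger0_norm (sqr_ge0 _)) normrM (gtr0_norm (std_pdf_gt0 _)) -/z.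
set u := z + x * s r.
have uz : z ^+ 2 <= 2 * u ^+ 2 + 2 * x ^+ 2 * s r ^+ 2.
  by rewrite /u; have := sqr_ge0 (z + 2 * (x * s r)); lra.
have h1 : `|z ^+ 2 - 1| <= 1 + 2 * u ^+ 2 + 2 * x ^+ 2 * s r ^+ 2.
  by have := sqr_ge0 z; have := sqr_ge0 (x * s r); have := sqr_ge0 u;
     rewrite ler_norml; nra.
have h2 : std_pdf z <= expR (- u ^+ 2 / 2)
    * (expR (1 - x ^+ 2 + x ^+ 2 * s r ^+ 2 / 2) * expR (x * r * v)).
  apply: le_trans (std_pdf_le z) _; rewrite -!expRD ler_expR.
  have : x * (r * (y - v)) <= 1.
    apply: le_trans xK; rewrite ler_wpM2l ?(ltW x_gt0)//.
    apply: le_trans (ler_norm _) _; rewrite normrM (ger0_norm r0).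
    by rewrite (le_trans _ yv)// ler_piMl.
  by move: zs; rewrite /u; nra.
have h3 : (1 + 2 * u ^+ 2 + 2 * x ^+ 2 * s r ^+ 2) * expR (- u ^+ 2 / 2)
    <= 5 + 2 * x ^+ 2 * s r ^+ 2.
  rewrite mulNr expRN ler_pdivrMr ?expR_gt0//.
  apply: (@le_trans _ _ ((5 + 2 * x ^+ 2 * s r ^+ 2) * (1 + u ^+ 2 / 2))).
    have := mulr_ge0 (sqr_ge0 (x * s r)) (sqr_ge0 u); have := sqr_ge0 u.
    by rewrite exprMn; lra.
  rewrite ler_wpM2l ?expR_ge1Dx//.
  by have := sqr_ge0 (x * s r); rewrite exprMn; lra.
rewrite (_ : B r v = (5 + 2 * x ^+ 2 * s r ^+ 2) * (expR (1 - x ^+ 2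
  + x ^+ 2 * s r ^+ 2 / 2) * expR (x * r * v)) * (r / s r) ^+ 2).
  rewrite ler_wpM2r ?sqr_ge0//.
  set Y := expR (1 - x ^+ 2 + x ^+ 2 * s r ^+ 2 / 2) * expR (x * r * v) in h2 *.
  have Y0 : 0 <= Y by apply: mulr_ge0; exact: expR_ge0.
  apply: le_trans (ler_pM (normr_ge0 _) (ltW (std_pdf_gt0 _)) h1 h2) _.
  by rewrite mulrA; exact: ler_wpM2r h3.
by rewrite /B; ring.
Qed.

(** The dependence on [r] cancels in the exponent: [x^2 s^2 / 2] from [B] and [x^2 r^2 / 2] from
    [mgf_le] add up to [x^2 (1 + q^2) / 2]. The constant 3 covers the 1 in [B], the error 1 of
    [mgf_le] and [x^2 q^2 / 2 <= 1/2]. *)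
Let EB_le r : 0 <= r <= 1 ->
  E (B r) <= (r / s r) ^+ 2 * (5 + 2 * x ^+ 2 * s r ^+ 2)
             * expR (3 - x ^+ 2 / 2).
Proof.
move=> r01; have [r0 r1] := andP r01.
have xr : x * r <= x by rewrite ler_piMr// ltW.
rewrite EZ -/(mgf _) -[leLHS]mulrA ler_wpM2l//.
  rewrite mulr_ge0 ?sqr_ge0//.
  by have := sqr_ge0 (x * s r); rewrite exprMn; lra.
have xr0 : 0 <= x * r by rewrite mulr_ge0// ltW.
have xrK : x * r * K <= 1 by apply: le_trans xK; rewrite ler_wpM2r.
apply: le_trans (ler_wpM2l (expR_ge0 _) (mgf_le xr0 xrK)) _.
rewrite -expRD ler_expR sqr_s// exprMn.
have h1 : expR 1 * eps * (x * r) ^+ 3 <= 1.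
  apply: le_trans xeps; rewrite ler_wpM2l ?mulr_ge0 ?expR_ge0//.
  by rewrite lerXn2r ?nnegrE// ltW.
have h2 : x ^+ 2 * q ^+ 2 <= 1 by rewrite -exprMn exprn_ile1.
lra.
Qed.

Let dF r : R := (s r)^-1 * (E (fun y => y * g r y) - E (g1 r)).

(** Because [r] and [s r] have constant sum of squares, the derivative of the interpolation is
    exactly the Stein discrepancy of the Gaussian density [g r], divided by [s r]. *)
Let is_derive_F r : 0 <= r <= 1 -> is_derive r 1 F (dF r).
Proof.
move=> r01; have [r0 r1] := andP r01.
have sr := s_gt0 r01.
have ds : is_derive r 1 s (- r / s r).
  have b0 : 0 < 1 + q ^+ 2 - r ^+ 2 by move: sr; rewrite sqrtr_gt0.
  have dsq := is_derive1_sqrt b0.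
  have db : is_derive r 1 (fun r => 1 + q ^+ 2 - r ^+ 2) (- (2 * r)).
    by apply: is_derive_eq; rewrite /GRing.scale /=; ring.
  have d := @is_derive1_comp _ Num.sqrt (fun r => 1 + q ^+ 2 - r ^+ 2) _ _ _ dsq db.
  apply: (is_derive_eq d); rewrite -/(s r); field.
  by rewrite gt_eqF.
have -> : dF r = E (fun y => std_pdf (zz r y) * (y / s r + zz r y * r / s r ^+ 2)).
  rewrite /dF mulrBr -!EZ -EB; apply: eq_bigr => j _; rewrite /g /g1.
  by congr (_ * _); field; rewrite gt_eqF.
apply: (@is_derive_E (fun r y => std_cdf (zz r y))
  (fun r y => std_pdf (zz r y) * (y / s r + zz r y * r / s r ^+ 2))) => y.
have sn : s r != 0 by rewrite gt_eqF.
have dv := is_deriveV sn ds.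
have dl : is_derive r 1 (fun r => r * y - x) y.
  by apply: is_derive_eq; rewrite /GRing.scale /=; ring.
have dz := is_deriveM dl dv.
have d := @is_derive1_comp _ std_cdf (zz ^~ y) r _ _
  (is_derive_std_cdf (zz r y)) dz.
apply: (is_derive_eq d); congr (_ * _); rewrite /zz /GRing.scale /=.
by field.
Qed.

Let dF_le r : 0 <= r <= 1 ->
  `|dF r| <= eps * (5 / q ^+ 3 + 2 * x ^+ 2 / q) * expR (3 - x ^+ 2 / 2).
Proof.
move=> r01; have [r0 r1] := andP r01; have sr := s_gt0 r01.
have qs := q_le_s r01.
rewrite /dF normrM gtr0_norm ?invr_gt0//.
have st : `|E (fun y => y * g r y) - E (g1 r)| <= eps * E (B r).
  apply: (stein (g := g r)) => y a aK.
  apply: (@taylor_bound _ (g r) (g1 r) (g2 r) K); last exact: aK.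
  - by move=> u; exact: is_derive_g.
  - by move=> u; exact: is_derive_g1.
  - by move=> u uy; exact: g2_le.
have siq : (s r)^-1 <= q^-1 by rewrite lef_pV2.
have si0 : 0 <= (s r)^-1 by rewrite invr_ge0 ltW.
have h := ler_wpM2l si0 (le_trans st (ler_wpM2l eps_ge0 (EB_le r01))).
apply: le_trans h _.
have -> : (s r)^-1 * (eps * ((r / s r) ^+ 2 * (5 + 2 * x ^+ 2 * s r ^+ 2)
    * expR (3 - x ^+ 2 / 2))) = eps * (r ^+ 2 * (5 * (s r)^-1 ^+ 3
    + 2 * x ^+ 2 * (s r)^-1)) * expR (3 - x ^+ 2 / 2).
  by field; rewrite gt_eqF.
rewrite ler_wpM2r ?expR_ge0// ler_wpM2l//.
apply: (@le_trans _ _ (5 * (s r)^-1 ^+ 3 + 2 * x ^+ 2 * (s r)^-1)).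
  rewrite ler_piMl ?exprn_ile1//.
  apply: addr_ge0; first by apply: mulr_ge0 => //; exact: exprn_ge0.
  by rewrite mulr_ge0// mulr_ge0 ?sqr_ge0.
rewrite -exprVn; apply: lerD; apply: ler_wpM2l => //; last first.
  by rewrite mulr_ge0 ?sqr_ge0.
by rewrite lerXn2r ?nnegrE ?invr_ge0 ?(ltW sr) ?(ltW q_gt0).
Qed.

(** At [r = 1] one has [s r = q], and at [r = 0] the law drops out and a Gaussian of variance
    [1 + q^2] remains. *)
Lemma smoothed_tail :
  `|E (fun y => std_cdf ((y - x) / q)) - std_cdf (- x / Num.sqrt (1 + q ^+ 2))|
  <= eps * (5 / q ^+ 3 + 2 * x ^+ 2 / q) * expR (3 - x ^+ 2 / 2).
Proof.
have F1 : E (fun y => std_cdf ((y - x) / q)) = F 1.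
  apply: eq_bigr => j _; rewrite /zz /s expr1n addrAC subrr add0r mul1r.
  by rewrite sqrtr_sqr gtr0_norm.
have F0 : std_cdf (- x / Num.sqrt (1 + q ^+ 2)) = F 0.
  rewrite -[LHS]E_cst; apply: eq_bigr => j _; rewrite /zz /s.
  by rewrite expr0n /= subr0 mul0r add0r.
rewrite F1 F0.
have dFr r : r \in `[0, 1] -> is_derive r 1 F (dF r).
  by rewrite in_itv /= => /is_derive_F.
have [|c c01 ->] := @MVT _ F dF 0 1 ltr01 (fun r r01 => dFr r (subset_itv_oo_cc r01)).
  by apply: derivable_within_continuous => r /dFr[].
rewrite subr0 mulr1; apply: dF_le.
by move: c01; rewrite in_itv /= => /andP[c0 c1]; rewrite !ltW.
Qed.

Definition upper_tail y : R := E (fun u => (y < u)%R%:R).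

(** A Markov inequality: above [y] the smoothed indicator is at least its value at [y]. *)
Lemma upper_tail_le y : x < y ->
  upper_tail y * std_cdf ((y - x) / q) <= std_cdf (- x / Num.sqrt (1 + q ^+ 2))
    + eps * (5 / q ^+ 3 + 2 * x ^+ 2 / q) * expR (3 - x ^+ 2 / 2).
Proof.
move=> xy; have := smoothed_tail; rewrite ler_norml => /andP[_].
rewrite lerBlDl; apply: le_trans; rewrite mulrC -EZ; apply: E_le => u.
case: ltP => [yu|_]; last by rewrite mulr0 std_cdf_ge0.
rewrite mulr1 std_cdf_homo// ler_wpM2r ?invr_ge0 ?(ltW q_gt0)//; lra.
Qed.

Lemma upper_tail_ge y : y < x -> 1 <= (x - y) / q ->
  std_cdf (- x / Num.sqrt (1 + q ^+ 2))
    - eps * (5 / q ^+ 3 + 2 * x ^+ 2 / q) * expR (3 - x ^+ 2 / 2)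
    - expR (3 - ((x - y) / q) ^+ 2 / 4 - x ^+ 2 / 2)
  <= upper_tail y.
Proof.
move=> yx k1; have := smoothed_tail; rewrite ler_norml => /andP[+ _].
set k := (x - y) / q in k1 *.
suff : E (fun u => std_cdf ((u - x) / q)) - upper_tail y
    <= expR (3 - k ^+ 2 / 4 - x ^+ 2 / 2) by lra.
rewrite -EB.
(* The smoothed indicator exceeds the sharp one only for [u <= y], where with [z = (u - x) / q] it
   is at most [exp (- z^2/2)]. Half of this exponent gives [k^2 / 4]; the other half, by completing
   a square, pays for the tilt [exp (x (u - x))], so that [mgf_le] supplies the factor
   [exp (- x^2/2)]. *)
apply: (@le_trans _ _ (E (fun u => expR (1 - k ^+ 2 / 4 - x ^+ 2) * expR (x * u)))).
  apply: E_le => u; case: ltP => [yu|uy].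
    apply: le_trans (mulr_ge0 (expR_ge0 _) (expR_ge0 _)).
    by rewrite subr_le0 std_cdf_le1.
  rewrite subr0; set z := (u - x) / q.
  have zk : k <= - z by rewrite -mulNr ler_wpM2r ?invr_ge0 ?(ltW q_gt0)//; lra.
  have z0 : 0 < - z by lra.
  have := std_tail_le z0; rewrite opprK => /le_trans; apply.
  apply: (@le_trans _ _ (std_pdf (- z))).
    by rewrite ler_piMr ?(ltW (std_pdf_gt0 _))// invf_le1//; lra.
  apply: le_trans (std_pdf_le _) _; rewrite -expRD ler_expR sqrrN.
  have zq : u - x = z * q by rewrite divfK ?gt_eqF.
  have -> : x * u = x ^+ 2 + x * (z * q) by rewrite -zq; ring.
  have : k ^+ 2 <= z ^+ 2.
    by rewrite -(sqrrN z) lerXn2r ?nnegrE//; lra.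
  have : 0 <= (z / 2 + x * q) ^+ 2 by exact: sqr_ge0.
  have : x ^+ 2 * q ^+ 2 <= 1 by rewrite -exprMn exprn_ile1.
  lra.
rewrite EZ -/(mgf _).
apply: le_trans (ler_wpM2l (expR_ge0 _) (mgf_le (ltW x_gt0) xK)) _.
rewrite -expRD ler_expR. have := xeps; lra.
Qed.

End moderate_deviations.

(** * Gumbel limits *)

Section gumbel_level.
Context {R : realType}.
Variable k : nat -> nat.
Hypothesis k_cvg : k @ \oo --> \oo.
Implicit Types x : R.

Let s n : R := Num.sqrt (2 * ln (k n)%:R).

(** The level [a_n x + b_n] of the theorem after centring and division by the standard deviation. *)
Definition gumbel_level x n : R := alpha (k n) * x + beta (k n).

Let c x n : R := x - (ln (ln (k n)%:R) + ln (4 * pi)) / 2.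

Let levelE x n : gumbel_level x n = s n + c x n / s n.
Proof. by rewrite /gumbel_level /beta /alpha -/(s n) invrK /c; ring. Qed.

Let lnk_cvg : ln (k n)%:R @[n --> \oo] --> (+oo : set_system R).
Proof.
apply/cvgryPge => A.
have /cvgryPge/(_ (expR A)) : (k n)%:R @[n --> \oo] --> (+oo : set_system R).
  exact/cvgrnyP.
apply: filterS => n kA; rewrite -[leLHS]expRK ler_ln ?posrE ?expR_gt0//.
exact: lt_le_trans (expR_gt0 _) kA.
Qed.

Lemma sqrt_ln_cvg : s n @[n --> \oo] --> (+oo : set_system R).
Proof.
apply/cvgryPge => A; have /cvgryPge/(_ (A ^+ 2)) := lnk_cvg.
apply: filterS => n kA; rewrite (le_trans (ler_norm A))// -sqrtr_sqr.
by apply: ler_wsqrtr; have := sqr_ge0 A; lra.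
Qed.

Let s_gt0 : \forall n \near \oo, 0 < s n.
Proof. by have /cvgryPgt/(_ 0) := sqrt_ln_cvg. Qed.

Let sV : (s n)^-1 @[n --> \oo] --> (0 : R).
Proof. by apply/gtr0_cvgV0 => //; exact: sqrt_ln_cvg. Qed.

Let sqrt_s_V : (Num.sqrt (s n))^-1 @[n --> \oo] --> (0 : R).
Proof.
apply/gtr0_cvgV0.
  by near=> n; rewrite sqrtr_gt0; near: n; exact: s_gt0.
apply/cvgryPge => A; have /cvgryPge/(_ (A ^+ 2)) := sqrt_ln_cvg.
apply: filterS => n kA; rewrite (le_trans (ler_norm A))// -sqrtr_sqr.
exact: ler_wsqrtr.
Unshelve. all: end_near. Qed.

Let sqr_s n : 0 < s n -> s n ^+ 2 = 2 * ln (k n)%:R.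
Proof. by rewrite sqrtr_gt0 => /ltW; exact: sqr_sqrtr. Qed.

Let c_s x : c x n / s n @[n --> \oo] --> (0 : R).
Proof.
pose b n : R := (`|x| + `|ln (4 * pi)| / 2) * (s n)^-1 + 2 * (Num.sqrt (s n))^-1.
have b0 : b n @[n --> \oo] --> (0 : R).
  rewrite [X in _ --> X](_ : _ = (`|x| + `|ln (4 * pi)| / 2) * 0 + 2 * 0); last by rewrite !mulr0 addr0.
  by apply: cvgD; apply: cvgMr.
apply: (@squeeze_cvgr _ _ _ _ (fun n => - b n) b) => //; last first.
  by rewrite -oppr0; exact: cvgN.
near=> n.
have sn : 0 < s n by near: n; exact: s_gt0.
have Lk : 1 <= ln (k n)%:R :> R by near: n; have /cvgryPge := lnk_cvg; exact.
set u := Num.sqrt (s n).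
have u0 : 0 < u by rewrite sqrtr_gt0.
have su : s n = u ^+ 2 by rewrite sqr_sqrtr// ltW.
(* Comparing with a fourth power turns [ln y < y] into a bound by the square root of [s n], which is
   negligible against [s n]. *)
have lnL : 0 <= ln (ln (k n)%:R : R) <= 4 * u.
  apply/andP; split; first exact: ln_ge0.
  have : ln (ln (k n)%:R : R) <= ln (u ^+ 4).
    rewrite ler_ln ?posrE ?exprn_gt0//; last by lra.
    by rewrite (exprM u 2 2) -su sqr_s//; lra.
  move=> /le_trans; apply; rewrite lnXn// -[_ *+ 4]mulr_natl ler_wpM2l//.
  by rewrite ltW// ln_sublinear.
rewrite -ler_norml normrM (@gtr0_norm _ (s n)^-1) ?invr_gt0//.
rewrite /b -/u (_ : 2 * u^-1 = (2 * u) * (s n)^-1); last first.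
  by rewrite su; field; rewrite gt_eqF.
rewrite -mulrDl ler_pM2r ?invr_gt0// /c.
have := ler_norm x; have := ler_norm (- x); rewrite normrN.
have := ler_norm (ln (4 * pi) : R); have := ler_norm (- ln (4 * pi) : R).
by rewrite normrN; rewrite ler_norml; case/andP: lnL; lra.
Unshelve. all: end_near. Qed.

Lemma level_ratio_cvg x : gumbel_level x n / s n @[n --> \oo] --> (1 : R).
Proof.
have : 1 + c x n / s n * (s n)^-1 @[n --> \oo] --> (1 + 0 * 0 : R).
  by apply: cvgD; [exact: cvg_cst|exact: cvgM].
rewrite mulr0 addr0; apply: cvg_trans; apply: near_eq_cvg; near=> n.
have sn : 0 < s n by near: n; exact: s_gt0.
by rewrite levelE; field; rewrite gt_eqF.
Unshelve. all: end_near. Qed.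

Let sqrtE (y : R) : 0 < y -> expR (ln y / 2) = Num.sqrt y.
Proof.
move=> y0; rewrite -[LHS]gtr0_norm ?expR_gt0// -sqrtr_sqr; congr Num.sqrt.
by rewrite -expRM_natr -[RHS]lnK// divfK ?pnatr_eq0.
Qed.

(** The definition of [beta] is made for this. Half the square of [s + c/s] is
    [ln k + c + (c/s)^2 / 2], and [exp (- c)] is [exp (- x)] times [sqrt (2 pi) s]. All factors
    cancel, and only [exp (- (c/s)^2 / 2)], which tends to 1, is left. *)
Lemma level_pdf_cvg x :
  (k n)%:R * std_pdf (gumbel_level x n) / s n @[n --> \oo] --> (expR (- x) : R).
Proof.
have : expR (- x) * expR (- ((c x n / s n) ^+ 2 / 2)) @[n --> \oo]
    --> (expR (- x) * 1 : R).
  apply: cvgMr; rewrite -[X in _ --> X]expR0.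
  have e0 : - ((c x n / s n) ^+ 2 / 2) @[n --> \oo] --> (0 : R).
    rewrite [X in _ --> X](_ : _ = - (0 * 0 / 2)); last by rewrite !mul0r oppr0.
    by apply: cvgN; apply: cvgMl; exact: cvgM (c_s x) (c_s x).
  by apply: (continuous_cvg _ _ e0); exact: continuous_expR.
rewrite mulr1; apply: cvg_trans; apply: near_eq_cvg; near=> n.
have sn : 0 < s n by near: n; exact: s_gt0.
have Lk : 1 <= ln (k n)%:R :> R by near: n; have /cvgryPge := lnk_cvg; exact.
have k0 : 0 < (k n)%:R :> R.
  by rewrite ltNge; apply/negP => k0; move: Lk; rewrite ln0//; lra.
have L0 : 0 < ln (k n)%:R :> R by lra.
have p0 : 0 < pi :> R by exact: pi_gt0.
have sp : 0 < Num.sqrt (2 * pi) :> R by rewrite sqrtr_gt0 mulr_gt0.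
rewrite /std_pdf.
have -> : - gumbel_level x n ^+ 2 / 2
  = - ln (k n)%:R + (- x + (ln (ln (k n)%:R * (4 * pi)) / 2 - (c x n / s n) ^+ 2 / 2)).
  have -> : ln (k n)%:R = s n ^+ 2 / 2 :> R by rewrite sqr_s//; lra.
  rewrite levelE lnM ?posrE ?mulr_gt0 ?divr_gt0 ?exprn_gt0//.
  have -> : ln (s n ^+ 2 / 2) = ln (ln (k n)%:R) :> R.
    by congr ln; rewrite sqr_s//; lra.
  rewrite (_ : ln (ln (k n)%:R) + ln (4 * pi) = 2 * (x - c x n)); last first.
    by rewrite /c; lra.
  field.
  by rewrite gt_eqF.
rewrite !expRD (expRN (ln _)) lnK ?posrE// sqrtE ?mulr_gt0//.
rewrite (_ : ln _ * (4 * pi) = 2 * pi * (2 * ln (k n)%:R)); last by ring.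
rewrite (@sqrtrM _ (2 * pi)) ?mulr_ge0 ?ltW// -/(s n).
by field; rewrite !gt_eqF.
Unshelve. all: end_near. Qed.

(** The two Mills bounds agree to first order with the density divided by the level, and the level
    is asymptotic to [s n]. *)
Lemma level_tail_cvg x :
  (k n)%:R * std_cdf (- gumbel_level x n) @[n --> \oo] --> (expR (- x) : R).
Proof.
pose r n := gumbel_level x n / s n.
have r1 : r n @[n --> \oo] --> (1 : R) by exact: level_ratio_cvg.
have p1 := @level_pdf_cvg x.
pose lo n := (k n)%:R * std_pdf (gumbel_level x n) / s n *
  (r n * ((s n)^-1 * (s n)^-1 + r n * r n)^-1).
pose hi n := (k n)%:R * std_pdf (gumbel_level x n) / s n * (r n)^-1.
apply: (@squeeze_cvgr _ _ _ _ lo hi).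
- near=> n.
  have sn : 0 < s n by near: n; exact: s_gt0.
  have rn : 0 < r n by near: n; exact: (cvgr_gt _ r1).
  have yE : gumbel_level x n = r n * s n by rewrite divfK ?gt_eqF.
  have y0 : 0 < gumbel_level x n by rewrite yE mulr_gt0.
  have e1 : 0 < 1 + gumbel_level x n ^+ 2 by rewrite ltr_wpDr ?sqr_ge0.
  apply/andP; split.
    apply: le_trans (ler_wpM2l (ler0n _ _) (std_tail_ge y0)).
    rewrite le_eqVlt; apply/orP; left; apply/eqP.
    rewrite /lo yE; field.
    by rewrite -yE !gt_eqF.
  apply: le_trans (ler_wpM2l (ler0n _ _) (std_tail_le y0)) _.
  rewrite le_eqVlt; apply/orP; left; apply/eqP.
  by rewrite /hi yE; field; rewrite (gt_eqF rn) (gt_eqF sn).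
- rewrite [X in _ --> X](_ : _ = expR (- x) * (1 * (0 * 0 + 1 * 1)^-1)); last first.
    by rewrite mulr0 add0r !mulr1 invr1 !mulr1.
  apply: cvgM => //; apply: cvgM => //; apply: cvgV.
    by rewrite mulr0 add0r mulr1 oner_neq0.
  by apply: cvgD; apply: cvgM.
- rewrite [X in _ --> X](_ : _ = expR (- x) * 1^-1); last by rewrite invr1 mulr1.
  by apply: cvgM => //; apply: cvgV => //; exact: oner_neq0.
Unshelve. all: end_near. Qed.

End gumbel_level.

(** * From moderate deviations to the tail at the Gumbel level *)

Section tail_asymptotics.
Context {R : realType}.
Variables (k : nat -> nat) (eps K : nat -> R) (T : nat -> R -> R).
Hypothesis k_cvg : k @ \oo --> \oo.
Let s n : R := Num.sqrt (2 * ln (k n)%:R).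
Hypotheses (eps_ge0 : forall n, 0 <= eps n) (K_ge0 : forall n, 0 <= K n).
Hypothesis eps_cvg : eps n * s n ^+ 7 @[n --> \oo] --> (0 : R).
Hypothesis K_cvg : s n * K n @[n --> \oo] --> (0 : R).

Let err n (x q : R) : R :=
  eps n * (5 / q ^+ 3 + 2 * x ^+ 2 / q) * expR (3 - x ^+ 2 / 2).

(** Only required for large [n], since standardising needs a positive standard deviation. *)
Hypothesis T_le : \forall n \near \oo, forall x q y : R, 0 < x -> 0 < q ->
  x * q <= 1 -> x * K n <= 1 -> expR 1 * eps n * x ^+ 3 <= 1 -> x < y ->
  T n y * std_cdf ((y - x) / q)
  <= std_cdf (- x / Num.sqrt (1 + q ^+ 2)) + err n x q.

Hypothesis T_ge : \forall n \near \oo, forall x q y : R, 0 < x -> 0 < q ->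
  x * q <= 1 -> x * K n <= 1 -> expR 1 * eps n * x ^+ 3 <= 1 -> y < x ->
  1 <= (x - y) / q ->
  std_cdf (- x / Num.sqrt (1 + q ^+ 2)) - err n x q
    - expR (3 - ((x - y) / q) ^+ 2 / 4 - x ^+ 2 / 2)
  <= T n y.

Let s_ge A : \forall n \near \oo, A <= s n.
Proof. by have /cvgryPge := @sqrt_ln_cvg R k k_cvg; exact. Qed.

Let sV : (s n)^-1 @[n --> \oo] --> (0 : R).
Proof.
apply/gtr0_cvgV0; last exact: sqrt_ln_cvg.
by have /cvgryPgt/(_ 0) := @sqrt_ln_cvg R k k_cvg.
Qed.

Let X z n : R := gumbel_level k z n.
Let rho z n : R := X z n / s n.

Let rho_cvg z : rho z n @[n --> \oo] --> (1 : R).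
Proof. exact: level_ratio_cvg. Qed.

Let rho_exp_cvg z m : rho z n ^+ m @[n --> \oo] --> (1 : R).
Proof.
rewrite [X in _ --> X](_ : _ = 1 ^+ m); last by rewrite expr1n.
apply: (@continuous_cvg _ _ _ _ _ (rho z) (fun t : R => t ^+ m)) => //.
exact: exprn_continuous.
Qed.

Let X_sub z eta n : X z n - X (z - eta) n = eta / s n.
Proof. by rewrite /X /gumbel_level /alpha -/(s n); ring. Qed.

Let range z : \forall n \near \oo, [/\ 1 <= s n, s n / 2 <= X z n <= 2 * s n,
  1 <= X z n, X z n * K n <= 1 & expR 1 * eps n * X z n ^+ 3 <= 1].
Proof.
have e0 : 0 < (8 * expR 1)^-1 :> R by rewrite invr_gt0 mulr_gt0 ?expR_gt0.
have [h12 h02] : 2^-1 < (1 : R) /\ 0 < (2^-1 : R) by lra.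
near=> n.
have s2 : 2 <= s n by near: n; exact: s_ge.
have sn : 0 < s n by lra.
have r1 : 2^-1 <= rho z n by near: n; exact: (cvgr_ge _ (@rho_cvg z)).
have r2 : rho z n <= 2.
  by near: n; apply: (cvgr_le _ (@rho_cvg z)); rewrite ltr1n.
have XE : X z n = rho z n * s n by rewrite divfK ?gt_eqF.
have sK : s n * K n <= 2^-1 by near: n; exact: (cvgr_le _ K_cvg).
have se : eps n * s n ^+ 7 <= (8 * expR 1)^-1.
  by near: n; exact: (cvgr_le _ eps_cvg).
have X1 : s n / 2 <= X z n <= 2 * s n.
  by rewrite XE ler_pM2r// r2 andbT mulrC ler_pM2r.
have [X2 X3] := andP X1.
split=> //; [lra|lra|by have := K_ge0 n; nra|].
apply: (@le_trans _ _ (expR 1 * eps n * (8 * s n ^+ 7))).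
  rewrite ler_wpM2l ?mulr_ge0 ?expR_ge0//.
  apply: (@le_trans _ _ ((2 * s n) ^+ 3)).
    by rewrite lerXn2r ?nnegrE//; lra.
  rewrite exprMn (_ : 2 ^+ 3 = 8 :> R); last by ring.
  by rewrite ler_wpM2l// ler_eXn2l//; lra.
have -> : expR 1 * eps n * (8 * s n ^+ 7) = 8 * expR 1 * (eps n * s n ^+ 7).
  by ring.
by rewrite -ler_pdivlMl ?mulr_gt0 ?expR_gt0// mulr1.
Unshelve. all: end_near. Qed.

Let P z n : R := (k n)%:R * std_pdf (X z n) / s n.

Let P_cvg z : P z n @[n --> \oo] --> (expR (- z) : R).
Proof. exact: level_pdf_cvg. Qed.

Let exp_level z n v : 0 < s n -> (k n)%:R * expR (v - X z n ^+ 2 / 2)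
  = P z n * (Num.sqrt (2 * pi) * (s n * expR v)).
Proof.
move=> sn; have sp : 0 < Num.sqrt (2 * pi) :> R.
  by rewrite sqrtr_gt0 mulr_gt0 ?pi_gt0.
rewrite /P /std_pdf expRD (_ : - X z n ^+ 2 / 2 = - (X z n ^+ 2 / 2)).
  by field; rewrite !gt_eqF.
by rewrite mulNr.
Qed.

(** Here the exponent 7 arises: [q = X^-2] turns [q^-3] into [X^6], and [k exp (- X^2/2)] is of
    order [s n]. *)
Let err_cvg z : (k n)%:R * err n (X z n) (X z n ^- 2) @[n --> \oo] --> (0 : R).
Proof.
have : (eps n * s n ^+ 7) * ((5 * rho z n ^+ 6 +
    2 * rho z n ^+ 4 * ((s n)^-1 * (s n)^-1)) * P z n *
    (Num.sqrt (2 * pi) * expR 3)) @[n --> \oo] --> 0 * ((5 * 1 + 2 * 1 * (0 * 0))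
    * expR (- z) * (Num.sqrt (2 * pi) * expR 3) : R).
  apply: cvgM => //; apply: cvgMl; apply: cvgM => //; apply: cvgD.
    exact: cvgMr.
  by apply: cvgM; [exact: cvgMr|exact: cvgM].
rewrite mul0r; apply: cvg_trans; apply: near_eq_cvg; near=> n.
have [s1 _ X1 _ _] : [/\ 1 <= s n, s n / 2 <= X z n <= 2 * s n,
  1 <= X z n, X z n * K n <= 1 & expR 1 * eps n * X z n ^+ 3 <= 1].
  by near: n; exact: range.
have sn : 0 < s n by lra.
have Xn : 0 < X z n by lra.
have -> : (k n)%:R * err n (X z n) (X z n ^- 2) =
    eps n * (5 / X z n ^- 2 ^+ 3 + 2 * X z n ^+ 2 / X z n ^- 2)
    * ((k n)%:R * expR (3 - X z n ^+ 2 / 2)).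
  by rewrite /err; set e := expR _; ring.
rewrite exp_level//.
rewrite /rho.
by field; rewrite !gt_eqF.
Unshelve. all: end_near. Qed.

(** The gap [eta / s n] between two neighbouring levels in units of the smoothing width [X^-2]; it
    grows like [s n], so the smoothing becomes invisible at that scale. *)
Let kappa eta z n : R := (eta / s n) / X z n ^- 2.

Let kappa_ge eta z : 0 < eta -> \forall n \near \oo, eta / 4 * s n <= kappa eta z n.
Proof.
move=> eta0; near=> n.
have [s1 /andP[Xs _] X1 _ _] : [/\ 1 <= s n, s n / 2 <= X z n <= 2 * s n,
  1 <= X z n, X z n * K n <= 1 & expR 1 * eps n * X z n ^+ 3 <= 1].
  by near: n; exact: range.
have sn : 0 < s n by lra.
rewrite /kappa invrK -!mulrA ler_pM2l//.
rewrite (mulrC (s n)^-1) ler_pdivlMr// [X in X <= _](_ : _ = (s n / 2) ^+ 2); last by field.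
by rewrite lerXn2r ?nnegrE//; lra.
Unshelve. all: end_near. Qed.

Let sqrt_1D_ge (q : R) : 1 <= Num.sqrt (1 + q ^+ 2) <= 1 + q ^+ 2.
Proof.
have q0 := sqr_ge0 q; have q1 : 0 <= 1 + q ^+ 2 by lra.
apply/andP; split; first by rewrite -[leLHS]sqrtr1 ler_wsqrtr//; lra.
rewrite -[leRHS]ger0_norm// -sqrtr_sqr ler_wsqrtr// expr2.
by rewrite -[leLHS]mul1r ler_wpM2r//; lra.
Qed.

(** The smoothing is centred one gap below the level, at [z - eta]. The second gap, down to
    [z - 2 * eta], absorbs the division by [sqrt (1 + q^2)]. *)
Let tail_le z eta : 0 < eta -> \forall n \near \oo,
  (k n)%:R * T n (X z n) * std_cdf (kappa eta (z - eta) n)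
  <= (k n)%:R * std_cdf (- X (z - 2 * eta) n)
     + (k n)%:R * err n (X (z - eta) n) (X (z - eta) n ^- 2).
Proof.
move=> eta0; near=> n.
have [s1 /andP[Xs _] X1 XK Xe] : [/\ 1 <= s n,
    s n / 2 <= X (z - eta) n <= 2 * s n, 1 <= X (z - eta) n,
    X (z - eta) n * K n <= 1 & expR 1 * eps n * X (z - eta) n ^+ 3 <= 1].
  by near: n; exact: range.
have s8 : 8 / eta <= s n by near: n; exact: s_ge.
have sn : 0 < s n by lra.
have Xsub := X_sub z eta n; have Xsub2 := X_sub (z - eta) eta n.
have Xz2 : z - eta - eta = z - 2 * eta by lra.
rewrite Xz2 in Xsub2.
set x := X (z - eta) n in Xs X1 XK Xe Xsub Xsub2 *.
have x0 : 0 < x by lra.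
have es0 : 0 < eta / s n by rewrite divr_gt0.
have q0 : 0 < x ^- 2 by rewrite invr_gt0 exprn_gt0.
have xq : x * x ^- 2 <= 1.
  by rewrite -exprVn expr2 mulrA divff ?gt_eqF// mul1r invf_le1.
have xlt : x < X z n by lra.
have H : T n (X z n) * std_cdf ((X z n - x) / x ^- 2)
    <= std_cdf (- x / Num.sqrt (1 + (x ^- 2) ^+ 2)) + err n x (x ^- 2).
  by move: (x) (x ^- 2) (X z n) x0 q0 xq XK Xe xlt; near: n; exact: T_le.
rewrite Xsub in H; rewrite -mulrA -mulrDr ler_wpM2l//.
apply: le_trans H _; rewrite lerD2r std_cdf_homo// mulNr lerN2.
have /andP[r1 r2] := sqrt_1D_ge (x ^- 2).
rewrite ler_pdivlMr ?(lt_le_trans ltr01)//.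
have -> : X (z - 2 * eta) n = x - eta / s n by lra.
have [xes|xes] := leP (x - eta / s n) 0.
  by apply: le_trans (ltW x0); rewrite mulr_le0_ge0// (le_trans ler01).
apply: le_trans (ler_wpM2l (ltW xes) r2) _.
(* The displacement caused by [sqrt (1 + q^2)] is at most [x q^2 = x^-3], while the gap is of order
   [1/x]. *)
have h : x * (x ^- 2) ^+ 2 <= eta / s n.
  rewrite ler_pdivlMr// (_ : x * (x ^- 2) ^+ 2 * s n = s n / x ^+ 3); last first.
    by field; rewrite gt_eqF.
  rewrite ler_pdivrMr ?exprn_gt0//.
  apply: (@le_trans _ _ (eta * (s n / 2) ^+ 3)).
    rewrite (_ : eta * _ = s n * ((eta * s n / 8) * s n)); last by field.
    rewrite ler_peMr ?(ltW sn)//.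
    have : 1 <= eta * s n / 8 by move: s8; rewrite ler_pdivrMr//; lra.
    by nra.
  by rewrite ler_pM2l// lerXn2r ?nnegrE//; lra.
by have := mulr_ge0 (ltW es0) (sqr_ge0 (x ^- 2)); lra.
Unshelve. all: end_near. Qed.

(** One gap is enough in this direction, since dividing by [sqrt (1 + q^2) >= 1] only increases the
    Gaussian tail. *)
Let tail_ge z eta : 0 < eta -> \forall n \near \oo,
  (k n)%:R * std_cdf (- X (z + eta) n)
  - (k n)%:R * err n (X (z + eta) n) (X (z + eta) n ^- 2)
  - P (z + eta) n * (Num.sqrt (2 * pi) * expR 3) *
      (64 / eta ^+ 2 * (s n)^-1)
  <= (k n)%:R * T n (X z n).
Proof.
move=> eta0; near=> n.
have [s1 /andP[Xs _] X1 XK Xe] : [/\ 1 <= s n,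
    s n / 2 <= X (z + eta) n <= 2 * s n, 1 <= X (z + eta) n,
    X (z + eta) n * K n <= 1 & expR 1 * eps n * X (z + eta) n ^+ 3 <= 1].
  by near: n; exact: range.
have s4 : 4 / eta <= s n by near: n; exact: s_ge.
have kap : eta / 4 * s n <= kappa eta (z + eta) n by near: n; exact: kappa_ge.
have sn : 0 < s n by lra.
have Xsub := X_sub (z + eta) eta n; rewrite addrK in Xsub.
have eX := @exp_level (z + eta) n (3 - kappa eta (z + eta) n ^+ 2 / 4) sn.
have P0 : 0 <= P (z + eta) n.
  apply: mulr_ge0; last by rewrite invr_ge0 ltW.
  by apply: mulr_ge0 => //; exact/ltW/std_pdf_gt0.
rewrite /kappa in eX kap.
set x := X (z + eta) n in Xs X1 XK Xe Xsub eX kap *.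
have x0 : 0 < x by lra.
have es0 : 0 < eta / s n by rewrite divr_gt0.
have q0 : 0 < x ^- 2 by rewrite invr_gt0 exprn_gt0.
have xq : x * x ^- 2 <= 1.
  by rewrite -exprVn expr2 mulrA divff ?gt_eqF// mul1r invf_le1.
have xlt : X z n < x by lra.
have es1 : 1 <= eta / 4 * s n by move: s4; rewrite ler_pdivrMr//; lra.
have kap1 : 1 <= (x - X z n) / x ^- 2 by rewrite Xsub; exact: le_trans kap.
have H : std_cdf (- x / Num.sqrt (1 + (x ^- 2) ^+ 2)) - err n x (x ^- 2)
    - expR (3 - ((x - X z n) / x ^- 2) ^+ 2 / 4 - x ^+ 2 / 2) <= T n (X z n).
  by move: (x) (x ^- 2) (X z n) x0 q0 xq XK Xe xlt kap1; near: n; exact: T_ge.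
rewrite Xsub in H.
apply: le_trans (ler_wpM2l (ler0n R (k n)) H); rewrite !mulrBr.
apply: lerB; first apply: lerB => //.
  rewrite ler_wpM2l// std_cdf_homo// mulNr lerN2.
  have /andP[r1 _] := sqrt_1D_ge (x ^- 2).
  by rewrite ler_pdivrMr ?(lt_le_trans ltr01)// ler_peMr// ltW.
rewrite eX -[leRHS]mulrA; apply: ler_wpM2l => //.
rewrite -[leRHS]mulrA ler_wpM2l ?sqrtr_ge0// expRD mulrCA ler_wpM2l ?expR_ge0//.
set kp := eta / s n / x ^- 2 in kap *.
rewrite expRN ler_pdivrMr ?expR_gt0//.
(* Bounding the exponential from below by its argument makes the factor [s n] of [exp_level] into a
   multiple of [1 / s n]; the constant 64 is [4 * 4 ^ 2]. *)
have h1 : (eta / 4 * s n) ^+ 2 / 4 <= expR (kp ^+ 2 / 4).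
  apply: le_trans (expR_ge1Dx _).
  have : (eta / 4 * s n) ^+ 2 <= kp ^+ 2.
    by rewrite lerXn2r ?nnegrE//; lra.
  by lra.
have c0 : 0 <= 64 / eta ^+ 2 * (s n)^-1.
  by rewrite mulr_ge0 ?invr_ge0 ?ltW// divr_gt0// exprn_gt0.
apply: le_trans (ler_wpM2l c0 h1).
rewrite le_eqVlt; apply/orP; left; apply/eqP; field.
by rewrite !gt_eqF.
Unshelve. all: end_near. Qed.

(** For fixed [eta], [tail_le] and [tail_ge] confine the sequence asymptotically between
    [exp (- (z + eta))] and [exp (- (z - 2 eta))]; [eta] is then taken small by continuity of the
    exponential. *)
Lemma gumbel_tail_cvg z :
  (k n)%:R * T n (gumbel_level k z n) @[n --> \oo] --> (expR (- z) : R).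
Proof.
have Phi1 eta y : 0 < eta -> std_cdf (kappa eta y n) @[n --> \oo] --> (1 : R).
  move=> eta0; apply: (cvg_comp _ _ _ std_cdf_cvgy).
  apply/cvgryPge => A; near=> n.
  have sA : A / (eta / 4) <= s n by near: n; exact: s_ge.
  apply: (@le_trans _ _ (eta / 4 * s n)).
    by move: sA; rewrite ler_pdivrMr ?divr_gt0// [eta / 4 * _]mulrC.
  by near: n; exact: kappa_ge.
apply/cvgrPdist_le => e e0.
have [eta eta0 [etaU etaL]] : exists2 eta : R, 0 < eta &
    expR (- (z - 2 * eta)) < expR (- z) + e /\ expR (- z) - e < expR (- (z + eta)).
  have /cvgrPdist_lt/(_ e e0)/nbhs_ballP[r /= r0 re] := @continuous_expR R (- z).
  have near_z y : `|- z - y| < r -> `|expR (- z) - expR y| < e by exact: re.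
  exists (r / 4); first by rewrite divr_gt0.
  split.
    have : `|- z - - (z - 2 * (r / 4))| < r by rewrite ltr_norml; lra.
    by move=> /near_z; rewrite ltr_norml => /andP[h1 h2]; lra.
  have : `|- z - - (z + r / 4)| < r by rewrite ltr_norml; lra.
  by move=> /near_z; rewrite ltr_norml => /andP[h1 h2]; lra.
have U : ((k n)%:R * std_cdf (- X (z - 2 * eta) n)
     + (k n)%:R * err n (X (z - eta) n) (X (z - eta) n ^- 2))
     * (std_cdf (kappa eta (z - eta) n))^-1 @[n --> \oo]
    --> ((expR (- (z - 2 * eta)) + 0) * 1^-1 : R).
  apply: cvgM; last by apply: cvgV; [exact: oner_neq0|exact: Phi1].
  by apply: cvgD => //; exact: level_tail_cvg.
have L : (k n)%:R * std_cdf (- X (z + eta) n)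
  - (k n)%:R * err n (X (z + eta) n) (X (z + eta) n ^- 2)
  - P (z + eta) n * (Num.sqrt (2 * pi) * expR 3) *
      (64 / eta ^+ 2 * (s n)^-1) @[n --> \oo]
    --> (expR (- (z + eta)) - 0 - expR (- (z + eta)) * (Num.sqrt (2 * pi) * expR 3)
       * (64 / eta ^+ 2 * 0) : R).
  apply: cvgB.
    by apply: cvgB => //; exact: level_tail_cvg.
  by apply: cvgM; [exact: cvgMl|exact: cvgMr].
rewrite addr0 invr1 mulr1 in U; rewrite subr0 !mulr0 subr0 in L.
near=> n.
have up : (k n)%:R * T n (X z n) <= expR (- z) + e.
  apply: le_trans (_ : _ <= ((k n)%:R * std_cdf (- X (z - 2 * eta) n)
     + (k n)%:R * err n (X (z - eta) n) (X (z - eta) n ^- 2))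
     * (std_cdf (kappa eta (z - eta) n))^-1) _.
    have p0 : 0 < std_cdf (kappa eta (z - eta) n).
      by near: n; exact: (cvgr_gt _ (Phi1 eta (z - eta) eta0)).
    by rewrite ler_pdivlMr//; near: n; exact: tail_le.
  by near: n; exact: (cvgr_le _ U).
have lo : expR (- z) - e <= (k n)%:R * T n (X z n).
  apply: le_trans (_ : _ <= (k n)%:R * std_cdf (- X (z + eta) n)
  - (k n)%:R * err n (X (z + eta) n) (X (z + eta) n ^- 2)
  - P (z + eta) n * (Num.sqrt (2 * pi) * expR 3) *
      (64 / eta ^+ 2 * (s n)^-1)) _.
    by near: n; exact: (cvgr_ge _ L).
  by near: n; exact: tail_ge.
by rewrite -/(X z n) ler_norml; lra.
Unshelve. all: end_near. Qed.

End tail_asymptotics.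

(** * The theorem *)

Section power_limit.
Context {R : realType}.
Variables (k : nat -> nat) (q : nat -> R) (l : R).
Hypothesis k_cvg : k @ \oo --> \oo.
Hypothesis q01 : \forall n \near \oo, 0 <= q n <= 1.
Hypothesis kq_cvg : (k n)%:R * q n @[n --> \oo] --> l.

(** Squeeze by [exp (- q / (1 - q)) <= 1 - q <= exp (- q)], both consequences of
    [1 + y <= exp y]. *)
Lemma power_cvg_expRN : (1 - q n) ^+ k n @[n --> \oo] --> (expR (- l) : R).
Proof.
have kR : (k n)%:R @[n --> \oo] --> (+oo : set_system R) by exact/cvgrnyP.
have kV : (k n)%:R^-1 @[n --> \oo] --> (0 : R).
  by apply/gtr0_cvgV0 => //; have /cvgryPgt/(_ 0) := kR.
have k0 : \forall n \near \oo, 0 < (k n)%:R :> R.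
  by have /cvgryPgt/(_ 0) := kR.
have q0 : q n @[n --> \oo] --> (0 : R).
  have : (k n)%:R * q n * (k n)%:R^-1 @[n --> \oo] --> (l * 0 : R).
    exact: cvgM.
  rewrite mulr0; apply: cvg_trans; apply: near_eq_cvg; near=> n.
  have kn : 0 < (k n)%:R :> R by near: n.
  by field; rewrite gt_eqF.
have expc (u : nat -> R) : u n @[n --> \oo] --> - l ->
    expR (u n) @[n --> \oo] --> expR (- l).
  by move=> ul; apply: (@continuous_cvg _ _ _ _ _ u expR) => //; exact: continuous_expR.
apply: (@squeeze_cvgr _ _ _ _ (fun n => expR (- ((k n)%:R * q n * (1 - q n)^-1)))
    (fun n => expR (- ((k n)%:R * q n)))).
- near=> n.
  have qn : 0 <= q n <= 1 by near: n.
  have q1 : q n < 1 by near: n; exact: (cvgr_lt _ q0).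
  have [q2 _] := andP qn; have u0 : 0 < 1 - q n by lra.
  apply/andP; split.
    rewrite -mulrA -mulrN expRM_natl lerXn2r ?nnegrE ?expR_ge0 ?(ltW u0)//.
    rewrite expRN invf_ple ?posrE ?expR_gt0//.
    apply: le_trans (expR_ge1Dx _); rewrite le_eqVlt; apply/orP; left.
    by apply/eqP; field; rewrite gt_eqF.
  rewrite -mulrN expRM_natl lerXn2r ?nnegrE ?expR_ge0 ?(ltW u0)//.
  exact: expR_ge1Dx.
- apply: expc; rewrite -[X in _ --> - X]mulr1; apply: cvgN; apply: cvgM => //.
  rewrite [X in _ --> X](_ : _ = (1 - 0)^-1); last by rewrite subr0 invr1.
  apply: cvgV; first by rewrite subr0 oner_neq0.
  by apply: cvgB; [exact: cvg_cst|exact: q0].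
- by apply: expc; exact: cvgN.
Unshelve. all: end_near. Qed.

End power_limit.

(** * The standardised inversion count *)

Section normalised_inversions.
Context {disp : measure_display} {T : measurableType disp} {R : realType}.
Variables (P : probability T R) (W : weyl) (n d : nat).
Variable Z : 'I_n -> {RV P >-> R}.
Hypothesis hZ : iid_with_law Z (unif_law W).

Let mu : R := fine 'E_P[Xinv W d Z].
Definition inv_sd : R := Num.sqrt (fine 'V_P[Xinv W d Z]).
(** Rescaling [law_stein]: the second derivative gains [inv_sd ^- 2], and the left-hand side carries
    one factor [inv_sd]. *)
Definition stein_error : R := (640 * n * d.+1 ^ 3)%:R / inv_sd ^+ 3.
Definition stein_radius : R := (16 * d.+1)%:R / inv_sd.

Lemma stein_error_ge0 : 0 <= stein_error.
Proof. by apply: divr_ge0; [exact: ler0n|apply: exprn_ge0; exact: sqrtr_ge0]. Qed.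

Lemma stein_radius_ge0 : 0 <= stein_radius.
Proof. by apply: divr_ge0; [exact: ler0n|exact: sqrtr_ge0]. Qed.

Let p (v : 'I_(2 * n ^ 2).+1) : R := inv_law W d Z v.
Let w (v : 'I_(2 * n ^ 2).+1) : R := (v%:R - mu) / inv_sd.

Definition inv_tail : R -> R := upper_tail p w.

Let sd2 : inv_sd ^+ 2 = law_mean W d Z (fun y => (y - mu) ^+ 2).
Proof.
rewrite sqr_sqrtr ?variance_Xinv//; apply: sumr_ge0 => v _.
by rewrite mulr_ge0 ?sqr_ge0 ?inv_law_ge0.
Qed.

Lemma inv_sd_sqr_ge : ((n - 2 * d) * d)%:R / 64 <= inv_sd ^+ 2.
Proof. by rewrite sd2; exact: law_variance_ge. Qed.

Hypothesis sd_gt0 : 0 < inv_sd.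

Lemma inv_tailE y : inv_tail y = law_mean W d Z (fun v => (inv_sd * y + mu < v)%R%:R).
Proof.
apply: eq_bigr => v _; congr (_ * _%:R).
by rewrite /w ltr_pdivlMr// mulrC ltrBrDr.
Qed.

Let stein (g g1 B : R -> R) :
  (forall x a, `|a| <= stein_radius ->
    `|g (x + a) - g x - a * g1 x| <= a ^+ 2 * B x
    /\ `|g1 (x + a) - g1 x| <= `|a| * B x) ->
  `|\sum_v p v * (w v * g (w v)) - \sum_v p v * g1 (w v)|
  <= stein_error * \sum_v p v * B (w v).
Proof.
move=> tay; pose f y : R := (y - mu) / inv_sd.
have sn : inv_sd != 0 by rewrite gt_eqF.
have h := @law_stein _ _ _ P W n d Z hZ (g \o f) (fun y => g1 (f y) / inv_sd)
  (fun y => B (f y) / inv_sd ^+ 2).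
have {h} : `|law_mean W d Z (fun y => (y - mu) * g (f y))
    - law_mean W d Z (fun y => (y - mu) ^+ 2)
      * law_mean W d Z (fun y => g1 (f y) / inv_sd)|
  <= (640 * n * d.+1 ^ 3)%:R * law_mean W d Z (fun y => B (f y) / inv_sd ^+ 2).
  apply: h => x a aK /=.
  have -> : f (x + a) = f x + a / inv_sd by rewrite /f; field.
  have aK' : `|a / inv_sd| <= stein_radius.
    by rewrite normrM (gtr0_norm (x := inv_sd^-1)) ?invr_gt0// ler_wpM2r// invr_ge0 ltW.
  have [t1 t2] := tay (f x) _ aK'; split.
    rewrite (_ : a * (g1 (f x) / inv_sd) = a / inv_sd * g1 (f x)); last by ring.
    apply: le_trans t1 _; rewrite le_eqVlt; apply/orP; left; apply/eqP.
    by field.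
  rewrite -mulrBl normrM (gtr0_norm (x := inv_sd^-1)) ?invr_gt0//.
  apply: le_trans (ler_wpM2r _ t2) _; first by rewrite invr_ge0 ltW.
  rewrite normrM (gtr0_norm (x := inv_sd^-1)) ?invr_gt0//.
  by rewrite le_eqVlt; apply/orP; left; apply/eqP; field.
rewrite -sd2 => h.
rewrite -(ler_pM2l sd_gt0) -[X in X * `|_|](gtr0_norm sd_gt0) -normrM.
have e1 : inv_sd * (\sum_v p v * (w v * g (w v)) - \sum_v p v * g1 (w v)) =
    law_mean W d Z (fun y => (y - mu) * g (f y))
    - inv_sd ^+ 2 * law_mean W d Z (fun y => g1 (f y) / inv_sd).
  rewrite mulrBr /law_mean !mulr_sumr; congr (_ - _);
    by apply: eq_bigr => v _; rewrite /w /f -/(p v); field.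
have e2 : inv_sd * (stein_error * \sum_v p v * B (w v)) =
    (640 * n * d.+1 ^ 3)%:R * law_mean W d Z (fun y => B (f y) / inv_sd ^+ 2).
  rewrite /stein_error /law_mean !mulr_sumr; apply: eq_bigr => v _.
  by rewrite /w /f -/(p v); field.
by rewrite e1 e2.
Qed.

Let p_ge0 v : 0 <= p v. Proof. exact: inv_law_ge0. Qed.

Let p_sum : \sum_v p v = 1.
Proof.
by rewrite -[RHS](law_mean1 W d Z); apply: eq_bigr => v _; rewrite mulr1.
Qed.

Lemma inv_tail01 y : 0 <= inv_tail y <= 1.
Proof.
apply/andP; split; first by apply: sumr_ge0 => v _; rewrite mulr_ge0.
rewrite -p_sum; apply: ler_sum => v _; rewrite ler_piMr//.
by case: (_ < _).
Qed.

Lemma inv_tail_le (x q y : R) : 0 < x -> 0 < q -> x * q <= 1 ->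
  x * stein_radius <= 1 -> expR 1 * stein_error * x ^+ 3 <= 1 -> x < y ->
  inv_tail y * std_cdf ((y - x) / q) <= std_cdf (- x / Num.sqrt (1 + q ^+ 2))
    + stein_error * (5 / q ^+ 3 + 2 * x ^+ 2 / q) * expR (3 - x ^+ 2 / 2).
Proof.
move=> x0 q0 xq xK xe xy.
exact: (upper_tail_le p_ge0 p_sum stein_error_ge0 stein_radius_ge0 stein
  x0 q0 xq xK xe xy).
Qed.

Lemma inv_tail_ge (x q y : R) : 0 < x -> 0 < q -> x * q <= 1 ->
  x * stein_radius <= 1 -> expR 1 * stein_error * x ^+ 3 <= 1 -> y < x ->
  1 <= (x - y) / q ->
  std_cdf (- x / Num.sqrt (1 + q ^+ 2))
    - stein_error * (5 / q ^+ 3 + 2 * x ^+ 2 / q) * expR (3 - x ^+ 2 / 2)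
    - expR (3 - ((x - y) / q) ^+ 2 / 4 - x ^+ 2 / 2)
  <= inv_tail y.
Proof.
move=> x0 q0 xq xK xe yx yx1.
exact: (upper_tail_ge p_ge0 p_sum stein_error_ge0 stein_radius_ge0 stein
  x0 q0 xq xK xe yx yx1).
Qed.

End normalised_inversions.

Section row_maximum.
Context {disp : measure_display} {T : measurableType disp} {R : realType}.
Variables (P : probability T R) (k : nat) (X : nat -> {RV P >-> R}).
Variable law : set R -> \bar R.
Hypothesis k_gt0 : (0 < k)%N.
Hypothesis hX : iid_with_law (fun j : 'I_k => X j) law.

Lemma prob_rowmax_le (y r : R) : law `]-oo, y]%classic = r%:E ->
  P [set t | rowmax k X t <= y] = (r ^+ k)%:E.
Proof.
move=> lawy; have [ind lawX] := hX.
have -> : [set t | rowmax k X t <= y] =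
    \bigcap_(j in [set` [set: 'I_k]%SET]) X j @^-1` `]-oo, y]%classic.
  apply/seteqP; split=> t /=.
    rewrite /rowmax => /bigmax_leP[_ le] j _ /=.
    by rewrite in_itv /=; exact: le.
  move=> le; rewrite /rowmax; apply/bigmax_leP; split=> [|j _].
    (* The starting value [X 0] of the maximum is itself an entry of the row, since [k] is
       positive. *)
    have /= := le (Ordinal k_gt0); rewrite in_itv /=; apply.
    by rewrite finset.in_setT.
  have /= := le j; rewrite in_itv /=; apply.
  by rewrite finset.in_setT.
rewrite ind//.
rewrite (eq_bigr (fun=> r%:E)); last first.
  by move=> j _; rewrite -lawy -(lawX j).
by rewrite prodEFin prodr_const cardsT card_ord.
Qed.

End row_maximum.

(** * Translation of the growth conditions into error rates *)

Section rates.
Context {R : realType}.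
Variables (d k : nat -> nat) (e : nat -> R^o).
Hypothesis d_gt0 : forall n, (2 <= n)%N -> (0 < d n)%N.
Hypothesis d_small :
  (fun n => (d n)%:R : R^o) =o_\oo (fun n => n%:R `^ (1 / 3) : R^o).
Hypothesis k_cvg : k @ \oo --> \oo.
Hypothesis e_small :
  e =o_\oo (fun n => n%:R `^ (1 / 7) * (d n)%:R `^ (- (3 / 7)) : R^o).
Hypothesis k_exp : forall n, (2 <= n)%N -> (k n)%:R = expR (e n).

Lemma near_quarter : \forall n \near \oo, (4 * d n <= n)%N.
Proof.
have /eqoP/(_ 4^-1) := d_small; rewrite invr_gt0 => /(_ (ltr0n _ _)) small.
near=> n.
have n1 : (1 <= n)%N by near: n; exact: nbhs_infty_ge.
have : `|(d n)%:R : R| <= 4^-1 * `|n%:R `^ (1 / 3)| by near: n.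
rewrite !ger0_norm ?powR_ge0// => /le_trans/(_ _)H.
have pn : n%:R `^ (1 / 3) <= n%:R :> R.
  rewrite -[leRHS](@powRr1 R) ?ler0n// ler_powR ?ler1n//; lra.
rewrite -(ler_nat R) natrM -ler_pdivlMl//; apply: H.
by rewrite ler_pM2l.
Unshelve. all: end_near. Qed.

(** The seventh power of the growth condition on [k], which clears all fractional exponents. *)
Lemma near_log_rate (delta : R) : 0 < delta -> \forall n \near \oo,
  ln (k n)%:R ^+ 7 * (d n)%:R ^+ 3 <= delta ^+ 7 * n%:R.
Proof.
move=> delta0; have /eqoP/(_ delta delta0) small := e_small.
near=> n.
have n2 : (2 <= n)%N by near: n; exact: nbhs_infty_ge.
have dn : 0 < (d n)%:R :> R by rewrite ltr0n d_gt0.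
have : `|e n| <= delta * `|n%:R `^ (1 / 7) * (d n)%:R `^ (- (3 / 7))| by near: n.
rewrite k_exp// expRK (ger0_norm (x := _ * _)) ?mulr_ge0 ?powR_ge0// => le.
have le7 : e n ^+ 7 <= (delta * (n%:R `^ (1 / 7) * (d n)%:R `^ (- (3 / 7)))) ^+ 7.
  apply: le_trans (ler_norm _) _; rewrite normrX lerXn2r ?nnegrE//.
  by rewrite !mulr_ge0 ?powR_ge0// ltW.
have p1 : (n%:R `^ (1 / 7)) ^+ 7 = n%:R :> R.
  rewrite -powR_mulrn ?powR_ge0// -powRrM (_ : 1 / 7 * 7%:R = 1); last by field.
  by rewrite powRr1.
have p2 : ((d n)%:R `^ (- (3 / 7))) ^+ 7 * (d n)%:R ^+ 3 = 1 :> R.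
  rewrite -powR_mulrn ?powR_ge0// -powRrM (_ : - (3 / 7) * 7%:R = - 3); last by field.
  by rewrite -[(d n)%:R ^+ 3]powR_mulrn// powRN mulVf// gt_eqF// powR_gt0.
apply: le_trans (ler_wpM2r _ le7) _; first by rewrite exprn_ge0// ltW.
move: p1 p2; set u := n%:R `^ _; set v := (d n)%:R `^ _ => p1 p2.
rewrite [leLHS](_ : _ = delta ^+ 7 * (u ^+ 7 * (v ^+ 7 * (d n)%:R ^+ 3))); last by ring.
by rewrite p1 p2 mulr1.
Unshelve. all: end_near. Qed.

Variables (A b v0 : R) (sd : nat -> R).
Hypotheses (A_gt0 : 0 < A) (b_gt0 : 0 < b) (v0_gt0 : 0 < v0).
Hypothesis sd_gt0 : \forall n \near \oo, 0 < sd n.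
Hypothesis sd_ge : \forall n \near \oo, v0 * n%:R * (d n)%:R <= sd n ^+ 2.

Let s n : R := Num.sqrt (2 * ln (k n)%:R).
Let eps n : R := A * n%:R * (d n).+1%:R ^+ 3 / sd n ^+ 3.

Let s_ge1 : \forall n \near \oo, 1 <= s n.
Proof. by have /cvgryPge := @sqrt_ln_cvg R k k_cvg; exact. Qed.

(** Squaring leaves only even powers of [sd n] and [s n], so that [sd_ge] and [s n ^+ 2 = 2 ln k]
    apply directly. *)
Lemma error_rate : eps n * s n ^+ 7 @[n --> \oo] --> (0 : R).
Proof.
apply/cvgr0Pnorm_le => eta eta0.
(* [2 ^+ 13] collects [2 ^+ 6] from [d + 1 <= 2 d] and [2 ^+ 7] from [(2 ln k) ^+ 7]. The minimum
   with 1 in [delta] serves to replace [delta ^+ 7] by [delta]. *)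
pose C : R := A ^+ 2 * 2 ^+ 13 / v0 ^+ 3.
have C0 : 0 < C by rewrite !mulr_gt0 ?invr_gt0 ?exprn_gt0.
pose delta : R := Num.min 1 (eta ^+ 2 / C).
have delta0 : 0 < delta by rewrite lt_min ltr01 divr_gt0 ?exprn_gt0.
have rate := near_log_rate delta0.
near=> n.
have n2 : (2 <= n)%N by near: n; exact: nbhs_infty_ge.
have dn1 : 1 <= (d n)%:R :> R by rewrite ler1n d_gt0.
have n0 : 0 < n%:R :> R by rewrite ltr0n; exact: leq_trans n2.
have d0 : 0 < (d n)%:R :> R by exact: lt_le_trans dn1.
have sdn : 0 < sd n by near: n.
have sn : 1 <= s n by near: n.
have v : v0 * n%:R * (d n)%:R <= sd n ^+ 2 by near: n.
have L7 : ln (k n)%:R ^+ 7 * (d n)%:R ^+ 3 <= delta ^+ 7 * n%:R by near: n.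
have s2 : s n ^+ 2 = 2 * ln (k n)%:R.
  by rewrite sqr_sqrtr//; apply: ltW; rewrite -sqrtr_gt0; exact: lt_le_trans sn.
have L0 : 0 <= ln (k n)%:R :> R by have := sqr_ge0 (s n); rewrite s2; lra.
set L := ln (k n)%:R in L7 s2 L0; set D : R := (d n).+1%:R.
have D2d : 0 <= D <= 2 * (d n)%:R by rewrite /D ler0n -natr1; lra.
have [D0 D2] := andP D2d.
have delta7 : delta ^+ 7 <= delta.
  have delta1 : delta <= 1 by rewrite /delta ge_min lexx.
  by rewrite -[leRHS]expr1 ler_wiXn2l// ltW.
have Cdelta : C * delta <= eta ^+ 2.
  by rewrite -ler_pdivlMl// mulrC /delta ge_min lexx orbT.
have key : (eps n * s n ^+ 7) ^+ 2 <= C * delta ^+ 7.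
  have -> : (eps n * s n ^+ 7) ^+ 2
      = A ^+ 2 * n%:R ^+ 2 * D ^+ 6 * (s n ^+ 2) ^+ 7 / (sd n ^+ 2) ^+ 3.
    by rewrite /eps -/D; field; rewrite gt_eqF.
  rewrite s2 ler_pdivrMr ?exprn_gt0//.
  apply: (@le_trans _ _ (A ^+ 2 * n%:R ^+ 2 * (2 * (d n)%:R) ^+ 6 * (2 * L) ^+ 7)).
    apply: ler_wpM2r; first by rewrite exprn_ge0// mulr_ge0.
    apply: ler_wpM2l; first by rewrite mulr_ge0 ?sqr_ge0.
    by rewrite lerXn2r ?nnegrE//; lra.
  have -> : A ^+ 2 * n%:R ^+ 2 * (2 * (d n)%:R) ^+ 6 * (2 * L) ^+ 7
    = A ^+ 2 * 2 ^+ 13 * n%:R ^+ 2 * (d n)%:R ^+ 3 * (L ^+ 7 * (d n)%:R ^+ 3).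
    by ring.
  apply: (@le_trans _ _ (A ^+ 2 * 2 ^+ 13 * n%:R ^+ 2 * (d n)%:R ^+ 3
      * (delta ^+ 7 * n%:R))).
    apply: ler_wpM2l L7; apply: mulr_ge0; last by rewrite exprn_ge0// ltW.
    by rewrite !mulr_ge0 ?exprn_ge0 ?(ltW A_gt0) ?(ltW n0).
  have -> : A ^+ 2 * 2 ^+ 13 * n%:R ^+ 2 * (d n)%:R ^+ 3 * (delta ^+ 7 * n%:R)
    = C * delta ^+ 7 * (v0 * n%:R * (d n)%:R) ^+ 3.
    by rewrite /C; field; rewrite gt_eqF.
  apply: ler_wpM2l; first by rewrite mulr_ge0 ?exprn_ge0 ?(ltW C0) ?(ltW delta0).
  have sd20 := sqr_ge0 (sd n).
  have vnd0 : 0 <= v0 * n%:R * (d n)%:R.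
    by apply: mulr_ge0; [apply: mulr_ge0|]; exact: ltW.
  by rewrite lerXn2r ?nnegrE.
rewrite -(@ler_pXn2r _ 2) ?nnegrE ?(ltW eta0)// real_normK ?num_real//.
apply: le_trans key (le_trans _ Cdelta).
by rewrite ler_wpM2l// ltW.
Unshelve. all: end_near. Qed.

(** The cube of this quantity is at most [b ^+ 3 / A] times [eps n * s n ^+ 7] as soon as [s n] and
    [n] are at least 1, so [error_rate] suffices. *)
Lemma radius_rate :
  s n * (b * (d n).+1%:R / sd n) @[n --> \oo] --> (0 : R).
Proof.
apply/cvgr0Pnorm_le => eta eta0.
have rate : \forall n \near \oo, eps n * s n ^+ 7 <= eta ^+ 3 * A / b ^+ 3.
  apply: (cvgr_le _ error_rate).
  by rewrite divr_gt0 ?mulr_gt0 ?exprn_gt0.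
near=> n.
have n1 : 1 <= n%:R :> R by rewrite ler1n; near: n; exact: nbhs_infty_ge.
have sdn : 0 < sd n by near: n.
have sn : 1 <= s n by near: n.
have sn0 : 0 <= s n by exact: le_trans sn.
have er : eps n * s n ^+ 7 <= eta ^+ 3 * A / b ^+ 3 by near: n.
set u := s n * _; have u0 : 0 <= u.
  by rewrite mulr_ge0// mulr_ge0 ?mulr_ge0 ?invr_ge0 ?(ltW b_gt0) ?(ltW sdn).
rewrite ger0_norm// -(@ler_pXn2r _ 3) ?nnegrE ?(ltW eta0)//.
have h : s n ^+ 3 * 1 <= s n ^+ 7 * n%:R.
  by rewrite ler_pM ?exprn_ge0// ler_weXn2l.
have e0 : 0 <= (b * (d n).+1%:R / sd n) ^+ 3.
  by rewrite exprn_ge0// mulr_ge0 ?mulr_ge0 ?invr_ge0 ?(ltW b_gt0) ?(ltW sdn).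
apply: (@le_trans _ _ (b ^+ 3 / A * (eps n * s n ^+ 7))).
  have := ler_wpM2l e0 h; rewrite /u /eps; set D := (d n).+1%:R => H.
  rewrite [leLHS](_ : _ = (b * D / sd n) ^+ 3 * (s n ^+ 3 * 1)); last by ring.
  apply: le_trans H _; rewrite le_eqVlt; apply/orP; left; apply/eqP.
  by field; rewrite !gt_eqF.
apply: le_trans (ler_wpM2l _ er) _; first by rewrite divr_ge0 ?exprn_ge0 ?ltW.
rewrite le_eqVlt; apply/orP; left; apply/eqP.
by field; rewrite !gt_eqF.
Unshelve. all: end_near. Qed.

End rates.

Theorem theorem4p2 (R : realType) (W : nat -> weyl) (d k : nat -> nat)
  (dispZ dispX : nat -> measure_display)
  (TZ : forall n, measurableType (dispZ n))
  (PZ : forall n, probability (TZ n) R)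
  (Z : forall n, 'I_n -> {RV (PZ n) >-> R})
  (TX : forall n, measurableType (dispX n))
  (PX : forall n, probability (TX n) R)
  (X : forall n, nat -> {RV (PX n) >-> R})
  (hd : forall n, (2 <= n)%N -> (1 <= d n <= dmax (W n) n - 1)%N)
  (hdo : (fun n => (d n)%:R : R^o) =o_\oo (fun n => n%:R `^ (1 / 3) : R^o))
  (hk : forall n, (2 <= n)%N -> (0 < k n)%N)
  (hkoo : k @ \oo --> \oo)
  (hke : exists2 e : nat -> R^o,
     e =o_\oo (fun n => n%:R `^ (1 / 7) * (d n)%:R `^ (- (3 / 7)) : R^o)
     & forall n, (2 <= n)%N -> (k n)%:R = expR (e n))
  (hZ : forall n, (2 <= n)%N -> iid_with_law (@Z n) (unif_law (W n)))
  (hX : forall n, (2 <= n)%N ->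
     iid_with_law (fun j : 'I_(k n) => X n j)
       (distribution (PZ n) (Xinv (W n) (d n) (@Z n)))) :
  let sigma n : R :=
    Num.sqrt (fine 'V_(PZ n)[Xinv (W n) (d n) (@Z n)]) in
  let a n : R := sigma n * alpha (k n) in
  let b n : R :=
    sigma n * beta (k n) + fine 'E_(PZ n)[Xinv (W n) (d n) (@Z n)] in
  forall x : R,
    PX n [set t | rowmax (k n) (X n) t <= a n * x + b n] @[n --> \oo]
      --> (expR (- expR (- x)))%:E.
Proof.
move=> sigma a b x; have [e e_small k_exp] := hke.
have d_gt0 n : (2 <= n)%N -> (0 < d n)%N by move=> /hd /andP[].
have v0 : 0 < 128^-1 :> R by rewrite invr_gt0.
(* The 64 of [inv_sd_sqr_ge] is doubled because [n - 2 d >= n / 2] once [4 d <= n]; the growth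
   condition on [d] provides the latter. *)
have sd_ge : \forall n \near \oo, 128^-1 * n%:R * (d n)%:R <= sigma n ^+ 2.
  have quarter := near_quarter hdo.
  near=> n.
  have n2 : (2 <= n)%N by near: n; exact: nbhs_infty_ge.
  have dn : (4 * d n <= n)%N by near: n.
  have := inv_sd_sqr_ge (d n) (hZ n n2). move=> V; apply: le_trans V.
  have h : (n * d n <= 2 * ((n - 2 * d n) * d n))%N.
    by rewrite mulnA leq_mul2r; apply/orP; right; lia.
  have : (n * d n)%:R <= (2 * ((n - 2 * d n) * d n))%:R :> R by rewrite ler_nat.
  by rewrite natrM (natrM _ 2); lra.
have sd_gt0 : \forall n \near \oo, 0 < sigma n.
  near=> n.
  have n2 : (2 <= n)%N by near: n; exact: nbhs_infty_ge.
  have h : 128^-1 * n%:R * (d n)%:R <= sigma n ^+ 2 by near: n.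
  rewrite lt_neqAle sqrtr_ge0 andbT; apply/eqP => s0.
  move: h; rewrite -s0 expr0n /= leNgt => /negP; apply.
  by rewrite !mulr_gt0 ?ltr0n ?d_gt0// (leq_trans _ n2).
pose T n := inv_tail (W n) (d n) (@Z n).
pose eps n := stein_error (W n) (d n) (@Z n).
pose K n := stein_radius (W n) (d n) (@Z n).
have T_cvg : (k n)%:R * T n (gumbel_level k x n) @[n --> \oo] --> expR (- x).
  apply: (@gumbel_tail_cvg R k eps K T) => //.
  - by move=> n; exact: stein_error_ge0.
  - by move=> n; exact: stein_radius_ge0.
  - have A0 : 0 < 640%:R :> R by rewrite ltr0n.
    have := error_rate d_gt0 hkoo e_small k_exp A0 v0 sd_gt0 sd_ge.
    by under eq_fun do rewrite -natrX -!natrM.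
  - have A0 : 0 < 640%:R :> R by rewrite ltr0n.
    have b0 : 0 < 16%:R :> R by rewrite ltr0n.
    have := radius_rate d_gt0 hkoo e_small k_exp A0 b0 v0 sd_gt0 sd_ge.
    by under eq_fun do rewrite -natrM.
  - near=> n.
    have n2 : (2 <= n)%N by near: n; exact: nbhs_infty_ge.
    have sn : 0 < sigma n by near: n.
    move=> y q z y0 q0 yq yK ye yz.
    exact: (inv_tail_le (hZ n n2) sn y0 q0 yq yK ye yz).
  - near=> n.
    have n2 : (2 <= n)%N by near: n; exact: nbhs_infty_ge.
    have sn : 0 < sigma n by near: n.
    move=> y q z y0 q0 yq yK ye yz yz1.
    exact: (inv_tail_ge (hZ n n2) sn y0 q0 yq yK ye yz yz1).
have T01 : \forall n \near \oo, 0 <= T n (gumbel_level k x n) <= 1.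
  by near=> n; exact: inv_tail01.
have main := power_cvg_expRN hkoo T01 T_cvg.
have rowmaxE : \forall n \near \oo,
    PX n [set t | rowmax (k n) (X n) t <= a n * x + b n]
    = ((1 - T n (gumbel_level k x n)) ^+ k n)%:E.
  near=> n.
  have n2 : (2 <= n)%N by near: n; exact: nbhs_infty_ge.
  have sn : 0 < sigma n by near: n.
  apply: (prob_rowmax_le (hk n n2) (hX n n2)).
  rewrite /distribution /pushforward prob_Xinv_le /T inv_tailE//.
  congr (1 - law_mean _ _ _ _)%:E; apply/funext => v.
  by rewrite /a /b /gumbel_level -[inv_sd _ _ _]/(sigma n); congr ((_ < v)%R%:R); ring.
apply/fine_cvgP; split.
  by apply: filterS rowmaxE => n ->.
apply: cvg_trans main; apply: near_eq_cvg.
by apply: filterS rowmaxE => n /= ->.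
Unshelve. all: end_near. Qed.
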